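(* Let $\mathcal H$ be a complex Hilbert space, let $n,m,k\in\mathbb N$ with $n,m,k\ge1$, let $A_i,C_i,D_i\in B(\mathcal H)$ for $i=1,\dots,n$, and let $p,q>1$ with $\frac1p+\frac1q=1$. Then for all real $r\ge1$, $$w^{2k}\Big(\sum_{i=1}^{n}D_iC_i^{m}A_i\Big)\le \frac{n^{2k-1}}{m}\sum_{j=1}^{m}\sum_{i=1}^{n}\Big\|\frac1p|C_i^{j}A_i|^{2rp}+\frac1q|(D_iC_i^{m-j})^*|^{2qr}\Big\|^{\frac kr}-r_0^{k}\inf_{\|\xi\|=1}\eta(\xi),$$ where $r_0=\min\{\frac1p,\frac1q\}$ and $$\eta(\xi)=\frac{n^{2k-1}}{m}\sum_{j=1}^{m}\sum_{i=1}^{n}\Big(\big\langle|C_i^{j}A_i|^{2p}\xi,\xi\big\rangle^{\frac k2}-\big\langle|(D_iC_i^{m-j})^*|^{2q}\xi,\xi\big\rangle^{\frac k2}\Big)^2 .$$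
   Context: $B(\mathcal H)$ is the $C^*$-algebra of bounded linear operators on $\mathcal H$ and $\|\cdot\|$ is the usual operator norm. For $T\in B(\mathcal H)$, $w(T)=\sup\{|\langle T\xi,\xi\rangle|:\xi\in\mathcal H,\ \|\xi\|=1\}$ is the numerical radius, $w^{s}(T)=(w(T))^{s}$, and $|T|=(T^*T)^{1/2}$. Real powers of positive operators are taken by continuous functional calculus, and $T^0=I$. *)

(* Defs.v *)
From HB Require Import structures.
From mathcomp Require Import all_boot all_order all_algebra.
From mathcomp Require Import sesquilinear complex.
From mathcomp Require Import all_classical all_reals all_analysis.

Set Implicit Arguments.
Unset Strict Implicit.
Unset Printing Implicit Defensive.

Import Order.TTheory GRing.Theory Num.Theory.
Import numFieldNormedType.Exports.
Local Open Scope classical_set_scope.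
Local Open Scope complex_scope.
Local Open Scope ring_scope.

(* A complex Hilbert space is a complete normed space H over R[i] together with
   an inner product dot, linear in its first argument, such that
   dot x x = `|x| ^+ 2.  Operators are functions H -> H satisfying bounded_op;
   sums and scalar multiples are the pointwise ones of the function space.
   The norm of H takes its values in R[i], hence the real parts below. *)

Section Operators.
Context {R : realType} {H : completeNormedModType R[i]}.
Implicit Types (T S : H -> H) (dot : {dot H for Num.conj}).

Definition bounded_op T : Prop :=
  linear T /\ exists M : R, forall x, `|T x| <= M%:C * `|x|.

Definition opnorm T : R :=
  sup [set complex.Re `|T x| | x in [set x : H | `|x| <= 1]].

Definition numradius dot T : R :=
  sup [set complex.Re `|dot (T x) x| | x in [set x : H | `|x| = 1]].

Definition adjoint dot T : H -> H :=
  xget 0 [set S | bounded_op S /\ forall x y, dot (T x) y = dot x (S y)].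

Definition spectrum T : set R[i] :=
  [set z | ~ exists S, [/\ bounded_op S,
                         S \o (T - z *: id) = id & (T - z *: id) \o S = id]].

Definition poly_op (P : {poly R[i]}) T : H -> H :=
  \sum_(i < size P) P`_i *: iter i T.

(* S = f(T) for a self-adjoint T and f continuous on the (real) spectrum of T:
   S is the norm limit of P(T) for polynomials P converging to f uniformly on
   the spectrum. *)
Definition is_calculus (f : R -> R) T S : Prop :=
  bounded_op S /\
  forall e : R, 0 < e -> exists P : {poly R[i]},
    (forall t : R, spectrum T t%:C -> `|P.[t%:C] - (f t)%:C| <= e%:C) /\
    opnorm (poly_op P T - S) <= e.

Definition calculus (f : R -> R) T : H -> H := xget 0 [set S | is_calculus f T S].

(* Meaningful for positive T and 0 <= s; note that 0 `^ 0 = 1. *)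
Definition op_power T (s : R) : H -> H := calculus (fun t => t `^ s) T.

Definition op_abs dot T : H -> H := op_power (adjoint dot T \o T) 2^-1.

End Operators.

(* Main.v *)
Require Import Defs.
From HB Require Import structures.
From mathcomp Require Import all_boot all_order all_algebra.
From mathcomp Require Import sesquilinear complex.
From mathcomp Require Import all_classical all_reals all_analysis.
From mathcomp Require Import ring lra.

Set Implicit Arguments.
Unset Strict Implicit.
Unset Printing Implicit Defensive.

Import Order.TTheory GRing.Theory Num.Theory.
Import numFieldNormedType.Exports.
Local Open Scope classical_set_scope.
Local Open Scope complex_scope.
Local Open Scope ring_scope.

(** Fix a unit vector xi.  By the triangle inequality and the power mean
    inequality, |<(sum_i D_i C_i^m A_i) xi, xi>|^2k is at most n^(2k-1) times
    the sum over i of |<D_i C_i^m A_i xi, xi>|^2k, and each of these terms can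
    be estimated in m ways, one for every splitting C^m = C^(m-j) C^j; the
    theorem averages them.  So it suffices to treat one product T S, with
    S = C^j A and T = D C^(m-j) ([refined_young_form]).  Cauchy-Schwarz gives

      |<T S xi, xi>|^2 <= |S xi|^2 |T^* xi|^2 = <X^2 xi, xi> <Y^2 xi, xi>

    for X = |S| and Y = |T^*|.  McCarthy's inequality
    <F xi, xi>^s <= <F^s xi, xi> for F positive and s >= 1
    ([real_calculus_jensen]) bounds the right-hand side by a^(1/p) b^(1/q),
    where a = <X^2p xi, xi> and b = <Y^2q xi, xi>.  The k-th power of this is
    controlled by a Young inequality with remainder ([refined_young_pow])

      (a^v b^w)^k + min(v,w)^k (a^(k/2) - b^(k/2))^2 <= (v a + w b)^k,

    and convexity of t^r followed by McCarthy's inequality turns v a + w b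
    into the quadratic form of the operator whose norm appears in the theorem.
    Taking the infimum of the remainders and the supremum over xi concludes.

    Most of the text builds the operator theory behind X^s.  Everything rests
    on one positivity statement ([rpoly_op_ge0]): if a real polynomial P is
    nonnegative on the real spectrum of a self-adjoint T, then
    <P(T) x, x> >= 0.  Otherwise the infimum m of this form over the unit
    sphere is negative, and P(T) - m is not bounded below; but it is a product
    of factors T - z with P(z) = m, one of which is then not bounded below, and
    this forces z to be a real point of the spectrum, where P is nonnegative.
    Approximating continuous functions by polynomials
    ([bernstein_approx]) yields the existence of the calculus and its
    monotonicity, and the latter gives McCarthy's inequality from the tangent
    line of t^s. *)

(** * The real Hilbert space underlying a complex one *)

Section RealForm.
Context {R : realType} {H : completeNormedModType R[i]}.
Implicit Types (x y z : H).

(** The norm of [H] is complex valued; its real part and that of the inner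
    product make [H] a real Hilbert space, in which all estimates are done. *)
Definition rnorm x : R := complex.Re `|x|.

Lemma rnormE x : `|x| = (rnorm x)%:C.
Proof. by rewrite /rnorm RRe_real ?normr_real. Qed.

Lemma rnorm_ge0 x : 0 <= rnorm x.
Proof. by rewrite -lecR -rnormE normr_ge0. Qed.

Lemma rnormD x y : rnorm (x + y) <= rnorm x + rnorm y.
Proof. by rewrite -lecR rmorphD/= -!rnormE ler_normD. Qed.

Lemma rnormN x : rnorm (- x) = rnorm x.
Proof. by rewrite /rnorm normrN. Qed.

Lemma rnormB x y : rnorm (x - y) = rnorm (y - x).
Proof. by rewrite -rnormN opprB. Qed.

Lemma rnorm0 : rnorm (0 : H) = 0.
Proof. by rewrite /rnorm normr0. Qed.

Lemma rnorm_eq0 x : rnorm x = 0 -> x = 0.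
Proof. by move=> x0; apply/normr0_eq0; rewrite rnormE x0. Qed.

Lemma rnormZ (s : R) x : rnorm (s%:C *: x) = `|s| * rnorm x.
Proof.
apply: complexI; rewrite -rnormE normrZ rmorphM/= -rnormE; congr (_ * _).
by rewrite normc_def/= expr0n addr0 sqrtr_sqr.
Qed.

Lemma Re_norm_ge0 (a : R[i]) : 0 <= complex.Re `|a|.
Proof. by rewrite -lecR RRe_real ?normr_real ?normr_ge0. Qed.

Lemma rnormZc (a : R[i]) x : rnorm (a *: x) = complex.Re `|a| * rnorm x.
Proof.
rewrite {1}/rnorm normrZ rnormE; have := RRe_real (normr_real a).
by move: (`|a|) => b <- /=; rewrite mulr0 subr0.
Qed.

Lemma rnorm_i x : rnorm ('i%C *: x) = rnorm x.
Proof.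
apply: complexI; rewrite -!rnormE normrZ; suff -> : `|'i%C| = 1 :> R[i] by rewrite mul1r.
by rewrite normc_def/= expr0n add0r expr1n sqrtr1.
Qed.

Lemma rnorm_complete (u : nat -> H) :
  (forall e : R, 0 < e -> exists N, forall n m, (N <= n)%N -> (N <= m)%N ->
     rnorm (u n - u m) <= e) ->
  exists l, forall e : R, 0 < e -> exists N, forall n, (N <= n)%N ->
     rnorm (u n - l) <= e.
Proof.
move=> cu.
have : cvg (u @ \oo).
  apply/cauchy_cvgP/cauchy_ballP => e e0.
  have er : e = (complex.Re e)%:C by rewrite RRe_real// gtr0_real.
  have e0' : 0 < complex.Re e by rewrite -ltcR -er.
  have [N hN] := cu (complex.Re e / 2) ltac:(by rewrite divr_gt0).
  exists (u @` [set n | (N <= n)%N], u @` [set n | (N <= n)%N]).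
    by split; exists N => // n Nn; exists n.
  move=> [_ _] [/= [n Nn <-] [k Nk <-]]; rewrite -ball_normE/= rnormE er ltcR.
  by apply: (le_lt_trans (hN _ _ Nn Nk)); lra.
move=> /cvg_ex[l ul]; exists l => e e0.
have /cvgrPdist_le/(_ e%:C) : u @ \oo --> l by [].
rewrite ltcR => /(_ e0)[N _ hN]; exists N => n Nn.
by rewrite rnormB -lecR -rnormE; apply: hN.
Qed.

Context (dot : {dot H for Num.conj}).
Context (dot_norm : forall x : H, dot x x = `|x| ^+ 2).

Definition rdot x y : R := complex.Re (dot x y).
Local Notation ip := rdot.

Lemma dotC x y : dot x y = (dot y x)^*.
Proof. by rewrite hermC expr0 mul1r. Qed.

Lemma rdotC x y : ip x y = ip y x.
Proof. by rewrite /rdot dotC; case: (dot y x). Qed.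

Lemma rdotDl x y z : ip (x + y) z = ip x z + ip y z.
Proof. by rewrite /rdot linearDl/=; case: (dot x z) => a b; case: (dot y z). Qed.

Lemma rdotZl (s : R) x y : ip (s%:C *: x) y = s * ip x y.
Proof.
by rewrite /rdot linearZl_LR/=; case: (dot x y) => a b /=; rewrite mul0r subr0.
Qed.

(** The real form of ['i *: x] recovers the imaginary part of the inner
    product, so that no information is lost by working with [rdot]. *)
Lemma rdot_i x y : ip ('i%C *: x) y = - complex.Im (dot x y).
Proof.
by rewrite /rdot linearZl_LR/=; case: (dot x y) => a b /=; rewrite mul0r mul1r sub0r.
Qed.

Lemma rdotDr x y z : ip z (x + y) = ip z x + ip z y.
Proof. by rewrite !(rdotC z) rdotDl. Qed.

Lemma rdotZr (s : R) x y : ip x (s%:C *: y) = s * ip x y.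
Proof. by rewrite !(rdotC x) rdotZl. Qed.

Lemma rdotNl x y : ip (- x) y = - ip x y.
Proof.
by rewrite -[- x]scaleN1r -(rmorphN1 (@real_complex R)) rdotZl mulN1r.
Qed.

Lemma rdotNr x y : ip x (- y) = - ip x y.
Proof. by rewrite !(rdotC x) rdotNl. Qed.

Lemma rdotBl x y z : ip (x - y) z = ip x z - ip y z.
Proof. by rewrite rdotDl rdotNl. Qed.

Lemma rdotBr x y z : ip z (x - y) = ip z x - ip z y.
Proof. by rewrite rdotDr rdotNr. Qed.

Lemma rdot0l x : ip 0 x = 0.
Proof. by rewrite -(subrr x) rdotBl subrr. Qed.

Lemma rdotii x y : ip ('i%C *: x) ('i%C *: y) = ip x y.
Proof.
rewrite rdot_i dotC linearZl_LR/= rdotC /rdot; case: (dot y x) => a b /=.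
by rewrite mul0r mul1r add0r opprK.
Qed.

Lemma rdotxx x : ip x x = rnorm x ^+ 2.
Proof. by rewrite /rdot dot_norm rnormE -rmorphXn. Qed.

Lemma rdot_inj x y : (forall h, ip x h = ip y h) -> x = y.
Proof.
move=> xy; apply/eqP; rewrite -subr_eq0; apply/eqP/rnorm_eq0/eqP.
by rewrite -sqrf_eq0 -rdotxx rdotBl xy subrr.
Qed.

Lemma dot_ext x y x' y' : (forall h, ip x (h *: y) = ip x' (h *: y')) ->
  dot x y = dot x' y'.
Proof.
move=> h; apply/eqP; rewrite eq_complex.
have := h 1; rewrite !scale1r /rdot => ->; rewrite eqxx/=.
have := h 'i%C; rewrite !(rdotC _ ('i%C *: _)) !rdot_i dotC [dot y' _]dotC.
by case: (dot x y) => a b; case: (dot x' y') => c d /= /eqP; rewrite !opprK.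
Qed.

Lemma rdot_le x y : ip x y <= rnorm x * rnorm y.
Proof.
have := rnorm_ge0 x; rewrite le_eqVlt => /orP[/eqP/esym/rnorm_eq0->|x0].
  by rewrite rnorm0 mul0r rdot0l.
have h : 0 <= ip ((rnorm y)%:C *: x - (rnorm x)%:C *: y)
                 ((rnorm y)%:C *: x - (rnorm x)%:C *: y).
  by rewrite rdotxx sqr_ge0.
move: h; rewrite !(rdotBl, rdotBr, rdotZl, rdotZr) !rdotxx (rdotC y x).
have [y0|y0] := leP (rnorm y) 0.
  have /rnorm_eq0 -> : rnorm y = 0 by apply/eqP; rewrite eq_le y0 rnorm_ge0.
  by rewrite rnorm0 mulr0 rdotC rdot0l.
move=> h; rewrite -(ler_pM2l (mulr_gt0 x0 y0)); lra.
Qed.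

Lemma rdot_norm x y : `|ip x y| <= rnorm x * rnorm y.
Proof. by rewrite ler_norml rdot_le andbT -lerNl -rdotNl -(rnormN x) rdot_le. Qed.

(** Cauchy-Schwarz for the complex form: rotate [x] by a phase that makes the
    inner product real and apply the real inequality. *)
Lemma dot_le x y : complex.Re `|dot x y| <= rnorm x * rnorm y.
Proof.
have [->|d0] := eqVneq (dot x y) 0.
  by rewrite normr0 mulr_ge0 ?rnorm_ge0.
set d := dot x y in d0 *; pose c := `|d| / d.
have -> : complex.Re `|d| = ip (c *: x) y.
  by rewrite /rdot linearZl_LR/= -/d /c divfK.
apply: (le_trans (rdot_le _ _)); apply: ler_wpM2r; first exact: rnorm_ge0.
rewrite -lecR -!rnormE normrZ /c normrM normr_id normfV divff ?mul1r//.
by rewrite normr_eq0.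
Qed.

End RealForm.

(** * Bounded operators and coercive forms *)

Section Bounded.
Context {R : realType} {H : completeNormedModType R[i]}.
Implicit Types (x y z h : H) (T S A : H -> H).

Lemma linD T x y : linear T -> T (x + y) = T x + T y.
Proof. by move=> lT; rewrite -[x]scale1r lT !scale1r. Qed.

Lemma lin0 T : linear T -> T 0 = 0.
Proof.
by move=> lT; apply: (@addrI _ (T 0)); rewrite -linD// !addr0.
Qed.

Lemma linZ T a x : linear T -> T (a *: x) = a *: T x.
Proof. by move=> lT; rewrite -[a *: x]addr0 lT lin0// addr0. Qed.

Lemma linN T x : linear T -> T (- x) = - T x.
Proof. by move=> lT; rewrite -scaleN1r linZ // scaleN1r. Qed.

Lemma linB T x y : linear T -> T (x - y) = T x - T y.
Proof. by move=> lT; rewrite linD// linN. Qed.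

Lemma bounded_op_rnorm T : bounded_op T ->
  exists2 M : R, 0 < M & forall x, rnorm (T x) <= M * rnorm x.
Proof.
move=> [_ [M hM]]; exists (`|M| + 1) => [|x].
  by rewrite ltr_wpDl.
have : rnorm (T x) <= M * rnorm x by rewrite -lecR rmorphM/= -!rnormE.
move=> /le_trans; apply; rewrite ler_wpM2r ?rnorm_ge0//.
by rewrite (le_trans (ler_norm M))// lerDl.
Qed.

Lemma rnorm_bounded_op T (M : R) : linear T -> (forall x, rnorm (T x) <= M * rnorm x) ->
  bounded_op T.
Proof.
by move=> lT hM; split=> //; exists M => x; rewrite !rnormE -rmorphM/= lecR.
Qed.

Lemma bounded_op_comp T S : bounded_op T -> bounded_op S -> bounded_op (T \o S).
Proof.
move=> bT bS; have [M M0 hM] := bounded_op_rnorm bT.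
have [N N0 hN] := bounded_op_rnorm bS.
apply: (@rnorm_bounded_op _ (M * N)) => [a x y|x /=].
  by rewrite /= bS.1 bT.1.
by rewrite (le_trans (hM _))// -mulrA ler_pM2l.
Qed.

Lemma bounded_op_id : bounded_op (id : H -> H).
Proof. by apply: (@rnorm_bounded_op _ 1) => // x; rewrite mul1r. Qed.

Lemma bounded_op_iter k T : bounded_op T -> bounded_op (iter k T).
Proof.
move=> bT; elim: k => [|k IH]; first exact: bounded_op_id.
exact: bounded_op_comp bT IH.
Qed.

Lemma bounded_opD T S : bounded_op T -> bounded_op S -> bounded_op (T + S).
Proof.
move=> bT bS; have [M M0 hM] := bounded_op_rnorm bT.
have [N N0 hN] := bounded_op_rnorm bS.
apply: (@rnorm_bounded_op _ (M + N)) => [a x y|x].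
  rewrite !fctE bS.1 bT.1 scalerDr !addrA; congr (_ + _).
  by rewrite -!addrA; congr (_ + _); rewrite addrC.
by rewrite fctE (le_trans (rnormD _ _))// mulrDl lerD.
Qed.

Lemma bounded_opZ a T : bounded_op T -> bounded_op (a *: T).
Proof.
move=> bT; have [M M0 hM] := bounded_op_rnorm bT.
apply: (@rnorm_bounded_op _ (complex.Re `|a| * M)) => [b x y|x].
  by rewrite !fctE bT.1 scalerDr !scalerA mulrC.
by rewrite fctE rnormZc -mulrA ler_wpM2l ?Re_norm_ge0.
Qed.

Lemma bounded_op0 : bounded_op (0 : H -> H).
Proof.
apply: (@rnorm_bounded_op _ 0) => [a x y|x].
  by change ((0 : H) = a *: 0 + 0); rewrite scaler0 addr0.
by change (rnorm (0 : H) <= 0 * rnorm x); rewrite rnorm0 mul0r.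
Qed.

Lemma bounded_op_sum (I : Type) (s : seq I) (F : I -> H -> H) :
  (forall i, bounded_op (F i)) -> bounded_op (\sum_(i <- s) F i).
Proof.
move=> bF; apply: (big_ind (fun T => bounded_op T)) => //.
- exact: bounded_op0.
- exact: bounded_opD.
Qed.

Lemma opnorm_ge T x : bounded_op T -> rnorm (T x) <= opnorm T * rnorm x.
Proof.
move=> bT; have [M M0 hM] := bounded_op_rnorm bT.
have := rnorm_ge0 x; rewrite le_eqVlt => /orP[/eqP/esym x0|x0].
  by rewrite x0 (rnorm_eq0 x0) lin0 ?rnorm0 ?mulr0//; case: bT.
rewrite -ler_pdivrMr// -(@ger0_norm _ (rnorm x)^-1) ?invr_ge0 ?rnorm_ge0//.
rewrite mulrC -rnormZ -linZ; last by case: bT.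
apply: sup_upper_bound; last first.
  exists ((rnorm x)^-1%:C *: x) => //=; rewrite rnormE rnormZ.
  by rewrite ger0_norm ?invr_ge0 ?rnorm_ge0// mulVf// gt_eqF.
split; first by exists (rnorm (T 0)), 0 => //=; rewrite normr0.
exists M => _ [y /= y1 <-]; apply: (le_trans (hM _)).
by rewrite ger_pMr// -lecR -rnormE.
Qed.

Lemma opnorm_le T e : (forall x, rnorm (T x) <= e * rnorm x) -> 0 <= e -> opnorm T <= e.
Proof.
move=> h e0; apply: ge_sup.
  by exists (rnorm (T 0)), 0 => //=; rewrite normr0.
move=> _ [y /= y1 <-]; apply: (le_trans (h _)).
by rewrite ler_piMr// -lecR -rnormE.
Qed.

Context (dot : {dot H for Num.conj}).
Context (dot_norm : forall x : H, dot x x = `|x| ^+ 2).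
Local Notation ip := (rdot dot).

(** Lax-Milgram for symmetric forms: a minimizing sequence of the energy
    <A x, x> - 2 phi x is Cauchy by the parallelogram identity, and the
    first-order condition at the limit is the equation.  With [A] the identity
    this is the Riesz representation, with [phi] an inner product it inverts
    [A]. *)
Lemma coercive_repr A (phi : H -> R) (d K L : R) :
  linear A -> (forall x y, ip (A x) y = ip x (A y)) ->
  0 < d -> (forall x, d * rnorm x ^+ 2 <= ip (A x) x) ->
  (forall x, rnorm (A x) <= K * rnorm x) ->
  (forall x y, phi (x + y) = phi x + phi y) ->
  (forall (s : R) x, phi (s%:C *: x) = s * phi x) ->
  (forall x, phi x <= L * rnorm x) ->
  exists z, forall h, ip (A z) h = phi h.
Proof.
move=> lA sA d0 cA bA phiD phiZ bphi.
pose J x := ip (A x) x - 2 * phi x.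
pose g x h := ip (A x) h - phi h.
have JD x h s : J (x + s%:C *: h) = J x + 2 * s * g x h + s ^+ 2 * ip (A h) h.
  rewrite /J /g linD// linZ// !(rdotDl, rdotDr, rdotZl, rdotZr) phiD phiZ.
  have -> : ip (A h) x = ip (A x) h by rewrite sA rdotC.
  by ring.
have Jlb x : - (L ^+ 2 / d) <= J x.
  have h1 := cA x; have h2 := bphi x.
  have : - (L ^+ 2) <= d * J x.
    have : d * (d * rnorm x ^+ 2) <= d * ip (A x) x by rewrite ler_pM2l.
    have : d * phi x <= d * (L * rnorm x) by rewrite (ler_pM2l d0).
    have := sqr_ge0 (d * rnorm x - L); rewrite /J; nra.
  by move=> h; rewrite -mulNr ler_pdivrMr// (mulrC (J x)).
pose E := [set J x | x in [set: H]].
have hE : has_inf E.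
  by split; [exists (J 0), 0 | exists (- (L ^+ 2 / d)) => _ [x _ <-]].
have mJ x : inf E <= J x by apply: ge_inf; [case: hE | exists x].
have /choice[u hu] : forall n : nat, exists x, J x < inf E + n.+1%:R^-1.
  move=> n; have [|_ [x _ <-] h] := @inf_adherent _ E n.+1%:R^-1 _ hE.
    by rewrite invr_gt0.
  by exists x.
have Jb x y : d * rnorm (x - y) ^+ 2 <= 2 * (J x + J y) - 4 * inf E.
  apply: (le_trans (cA _)).
  have h1 := JD y (x - y) 1; have h2 := JD y (x - y) 2^-1.
  rewrite scale1r addrC subrK in h1.
  have := mJ (y + 2^-1%:C *: (x - y)); rewrite h2 h1; lra.
have small (e : R) : 0 < e -> exists N, forall n, (N <= n)%N -> n.+1%:R^-1 <= e.
  move=> e0; have [N hN] := ltr_add_invr e0.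
  exists N => n Nn; rewrite add0r in hN; apply: ltW; apply: le_lt_trans hN.
  by rewrite lef_pV2 ?posrE// ler_nat.
have [z hz] : exists l, forall e : R, 0 < e -> exists N, forall n, (N <= n)%N ->
     rnorm (u n - l) <= e.
  apply: rnorm_complete => e e0.
  have [N hN] := small (d * e ^+ 2 / 4) ltac:(by rewrite divr_gt0// mulr_gt0// exprn_gt0).
  exists N => n m Nn Nm.
  rewrite -(@ler_pXn2r _ 2) ?nnegrE ?rnorm_ge0 ?(ltW e0)// -(ler_pM2l d0).
  apply: (le_trans (Jb _ _)).
  have := hN _ Nn; have := hN _ Nm; have := hu n; have := hu m.
  move: (n.+1%:R^-1) (m.+1%:R^-1) (J (u n)) (J (u m)) (inf E) (d * e ^+ 2) => *.
  lra.
exists z => h; apply/eqP; rewrite -subr_eq0 -/(g z h).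
(* First-order condition: z minimizes the energy along the line z + s h. *)
have key s : 0 <= 2 * s * g z h + s ^+ 2 * ip (A h) h.
  apply/ler_addgt0Pr => e e0.
  have [N1 h1] := small (e / 2) ltac:(by rewrite divr_gt0).
  pose c := 2 * `|s| * `|K| * rnorm h.
  have c0 : 0 <= c by rewrite !mulr_ge0// rnorm_ge0.
  have [N2 h2] := hz (e / 2 / (c + 1)) ltac:(by rewrite !divr_gt0// ltr_wpDl).
  pose n := maxn N1 N2.
  have {}h1 := h1 n (leq_maxl _ _); have {}h2 := h2 n (leq_maxr _ _).
  have h3 := mJ (u n + s%:C *: h); rewrite JD in h3.
  have h4 := hu n.
  have gE : g (u n) h = g z h + ip (A (u n - z)) h.
    by rewrite /g linB// rdotBl; ring.
  have h5 : 2 * s * ip (A (u n - z)) h <= e / 2.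
    apply: (le_trans (ler_norm _)); rewrite !normrM ger0_norm//.
    apply: (@le_trans _ _ (2 * `|s| * (`|K| * rnorm (u n - z) * rnorm h))).
      rewrite ler_wpM2l ?mulr_ge0//; apply: (le_trans (rdot_norm dot_norm _ _)).
      rewrite ler_wpM2r ?rnorm_ge0//; apply: (le_trans (bA _)).
      by rewrite ler_wpM2r ?rnorm_ge0// ler_norm.
    have -> : 2 * `|s| * (`|K| * rnorm (u n - z) * rnorm h) = c * rnorm (u n - z).
      by rewrite /c; ring.
    apply: (@le_trans _ _ ((c + 1) * rnorm (u n - z))).
      by rewrite ler_wpM2r ?rnorm_ge0// lerDl.
    by rewrite -ler_pdivlMl ?ltr_wpDl// mulrC.
  rewrite gE mulrDr in h3.
  move: h3 h4 h5 h1; move: (n.+1%:R^-1) (J (u n)) (inf E) (2 * s * _) (2 * s * _).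
  by move=> *; lra.
have b0 : 0 <= ip (A h) h.
  by apply: le_trans (cA h); rewrite mulr_ge0 ?sqr_ge0 ?ltW.
set b := ip (A h) h in key b0; set G := g z h in key *.
have b1 : 0 < b + 1 by rewrite ltr_wpDl.
(* The value of s that makes the left-hand side negative unless G = 0. *)
have := key (- G / (b + 1)).
have -> : 2 * (- G / (b + 1)) * G + (- G / (b + 1)) ^+ 2 * b =
  - ((b + 2) / (b + 1) ^+ 2) * G ^+ 2 by field; rewrite gt_eqF.
rewrite mulNr oppr_ge0 pmulr_rle0; last by rewrite divr_gt0 ?exprn_gt0 ?ltr_wpDl.
by rewrite le_eqVlt ltNge sqr_ge0 orbF sqrf_eq0.
Qed.

End Bounded.

(** * Adjoints, coercive operators and the spectrum *)

Section SelfAdjoint.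
Context {R : realType} {H : completeNormedModType R[i]}.
Context (dot : {dot H for Num.conj}).
Context (dot_norm : forall x : H, dot x x = `|x| ^+ 2).
Local Notation ip := (rdot dot).
Implicit Types (x y z h : H) (T S A : H -> H).

Definition selfadjoint T := bounded_op T /\ forall x y, ip (T x) y = ip x (T y).

Definition bounded_below T :=
  exists2 d : R, 0 < d & forall x, d * rnorm x <= rnorm (T x).

Lemma selfadjointBc T (t : R) : selfadjoint T -> selfadjoint (T - t%:C *: id).
Proof.
move=> [bT sT]; split=> [|x y].
  rewrite -scaleNr; apply: bounded_opD => //; apply: bounded_opZ.
  exact: bounded_op_id.
by rewrite !fctE !(rdotBl, rdotBr, rdotZl, rdotZr) sT.
Qed.

(** [adjoint] is chosen among the operators satisfying the defining identity;
    the Riesz representation of x |-> <T x, y> shows that there is one. *)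
Lemma adjoint_spec T : bounded_op T -> bounded_op (adjoint dot T) /\
  forall x y, dot (T x) y = dot x (adjoint dot T y).
Proof.
move=> bT; have [M M0 hM] := bounded_op_rnorm bT; have lT := bT.1.
suff [S hS] : exists S, bounded_op S /\ forall x y, dot (T x) y = dot x (S y).
  rewrite /adjoint; set E := [set S | _].
  by have : E (xget 0 E) by apply: (@xgetPex _ 0 E); exists S.
have /choice[S hS] y : exists z, forall h, ip z h = ip (T h) y.
  apply: (@coercive_repr _ _ _ dot_norm id (fun h => ip (T h) y) 1 1 (M * rnorm y)) => //.
  - by move=> x; rewrite mul1r (rdotxx dot_norm).
  - by move=> x; rewrite mul1r.
  - by move=> x z; rewrite linD// rdotDl.
  - by move=> s x; rewrite linZ// rdotZl.
  - move=> x; rewrite mulrAC; apply: (le_trans (rdot_le dot_norm _ _)).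
    by rewrite ler_wpM2r ?rnorm_ge0.
have dS x y : dot (T x) y = dot x (S y).
  rewrite dotC [RHS]dotC; congr (_^*); apply: (dot_ext (x := y)) => h.
  by rewrite -linZ// rdotC -hS.
exists S; split=> //; apply: (@rnorm_bounded_op _ _ _ M) => [a x y|y].
  apply: (rdot_inj dot_norm) => h; rewrite -!(rdotC _ h) /rdot -dS.
  by rewrite !linearDr/= !linearZr_LR/= !dS.
have := hS y (S y); rewrite (rdotxx dot_norm) => h.
have := rnorm_ge0 (S y); rewrite le_eqVlt => /orP[/eqP<-|s0].
  by rewrite mulr_ge0 ?rnorm_ge0 ?ltW.
rewrite -(ler_pM2l s0) -expr2 h; apply: (le_trans (rdot_le dot_norm _ _)).
by rewrite mulrA (mulrC _ M) ler_wpM2r ?rnorm_ge0.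
Qed.

Lemma coercive_inverse A (d : R) : selfadjoint A -> 0 < d ->
  (forall x, d * rnorm x ^+ 2 <= ip (A x) x) ->
  exists S, [/\ bounded_op S, S \o A = id & A \o S = id].
Proof.
move=> [bA sA] d0 cA; have [K K0 hK] := bounded_op_rnorm bA; have lA := bA.1.
have blw x : d * rnorm x <= rnorm (A x).
  have := rnorm_ge0 x; rewrite le_eqVlt => /orP[/eqP<-|x0].
    by rewrite mulr0 rnorm_ge0.
  rewrite -(ler_pM2r x0) -mulrA -expr2; apply: (le_trans (cA x)).
  exact: rdot_le.
have injA x y : A x = A y -> x = y.
  move=> e; apply/eqP; rewrite -subr_eq0; apply/eqP/rnorm_eq0.
  have := blw (x - y); rewrite linB// e subrr rnorm0 pmulr_rle0// => h.
  by apply/eqP; rewrite eq_le h rnorm_ge0.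
have /choice[S hS] y : exists z, A z = y.
  have [|||z hz] := @coercive_repr _ _ _ dot_norm A (fun h => ip y h) d K (rnorm y)
    lA sA d0 cA hK.
  - by move=> x z; rewrite rdotDr.
  - by move=> s x; rewrite rdotZr.
  - by move=> x; apply: rdot_le.
  - by exists z; apply: (rdot_inj dot_norm).
exists S; split.
- apply: (@rnorm_bounded_op _ _ _ d^-1) => [a x y|x].
    by apply: injA; rewrite lA !hS.
  by rewrite ler_pdivlMl//; have := blw (S x); rewrite hS.
- by apply/funext => x /=; apply: injA; rewrite hS.
- by apply/funext => x /=; rewrite hS.
Qed.

(** For t < 0 the operator T - t is coercive, and for t > M so is t - T. *)
Lemma spectrum_pos T (M t : R) : selfadjoint T ->
  (forall x, 0 <= ip (T x) x) -> (forall x, ip (T x) x <= M * rnorm x ^+ 2) ->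
  spectrum T t%:C -> 0 <= t <= M.
Proof.
move=> saT pT uT spT; apply/andP; split; rewrite leNgt; apply/negP => ht; apply: spT.
  apply: (@coercive_inverse _ (- t)); [exact: selfadjointBc|by rewrite oppr_gt0|].
  by move=> x; rewrite !fctE rdotBl rdotZl (rdotxx dot_norm) mulNr lerBrDr addNr.
have saA := selfadjointBc t saT.
have [bA sA] : selfadjoint ((-1)%:C *: (T - t%:C *: id)).
  split; first exact: bounded_opZ saA.1.
  by move=> x y; rewrite fctE rdotZl saA.2 -rdotZr.
have [|x|S [bS SA AS]] := @coercive_inverse _ (t - M) (conj bA sA).
- by rewrite subr_gt0.
- rewrite !fctE rdotZl rdotBl rdotZl (rdotxx dot_norm) mulrBl mulN1r opprB.
  by rewrite lerD2l lerN2.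
exists ((-1)%:C *: S); split; first exact: bounded_opZ.
  apply/funext => x; rewrite -[RHS](congr1 (@^~ x) SA)/= !fctE.
  by rewrite -linZ//; case: bS.
apply/funext => x; rewrite -[RHS](congr1 (@^~ x) AS)/= !fctE.
have lT : linear T by case: saT.1.
by rewrite linZ// scalerBr !scalerA mulrC.
Qed.

End SelfAdjoint.

(** * Positivity of polynomials in a self-adjoint operator *)

Section Poly.
Context {R : realType} {H : completeNormedModType R[i]}.
Implicit Types (x y z h : H) (T S A : H -> H) (P Q : {poly R[i]}).

(** Padding with zero coefficients puts polynomials of different sizes on the
    same footing, which linearity in the polynomial needs. *)
Lemma poly_op_widen n P T x : (size P <= n)%N ->
  poly_op P T x = \sum_(i < n) P`_i *: iter i T x.
Proof.
move=> Pn; rewrite /poly_op fct_sumE (big_ord_widen _ (fun i => (P`_i *: iter i T) x) Pn).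
rewrite big_mkcond/=; apply: eq_bigr => i _; case: ltnP => // h.
by rewrite nth_default// scale0r.
Qed.

Lemma poly_opD P Q T x : poly_op (P + Q) T x = poly_op P T x + poly_op Q T x.
Proof.
pose n := maxn (size P) (size Q).
rewrite !(@poly_op_widen n) ?leq_maxl ?leq_maxr ?size_polyD// -big_split/=.
by apply: eq_bigr => i _; rewrite coefD scalerDl.
Qed.

Lemma poly_opZ a P T x : poly_op (a *: P) T x = a *: poly_op P T x.
Proof.
rewrite !(@poly_op_widen (size P)) ?size_scale_leq// scaler_sumr.
by apply: eq_bigr => i _; rewrite coefZ scalerA.
Qed.

Lemma poly_opC c T x : poly_op c%:P T x = c *: x.
Proof. by rewrite (@poly_op_widen 1) ?size_polyC_leq1// big_ord1 coefC. Qed.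

Lemma poly_opMX P T x : poly_op (P * 'X) T x = poly_op P T (T x).
Proof.
rewrite (@poly_op_widen (size P).+1); last first.
  by rewrite (leq_trans (size_polyMleq _ _))// size_polyX addn2.
rewrite (@poly_op_widen (size P))// big_ord_recl coefMX/= scale0r add0r.
by apply: eq_bigr => i _; rewrite coefMX/= -iterS iterSr.
Qed.

Lemma poly_opX T x : poly_op 'X T x = T x.
Proof. by rewrite -['X]mul1r poly_opMX poly_opC scale1r. Qed.

Lemma poly_op_lin P T : linear T -> linear (poly_op P T).
Proof.
move=> lT a x y; elim/poly_ind: P x y => [|P c IH] x y.
  by rewrite -polyC0 !poly_opC !scale0r scaler0 addr0.
rewrite !poly_opD !poly_opC !poly_opMX lT IH !scalerDr !scalerA.
by rewrite -!addrA (mulrC c); congr (_ + _); rewrite addrCA.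
Qed.

Lemma poly_opXM P T x : linear T -> poly_op ('X * P) T x = T (poly_op P T x).
Proof.
move=> lT; elim/poly_ind: P x => [|P c IH] x.
  by rewrite mulr0 -polyC0 !poly_opC !scale0r lin0.
rewrite mulrDr mulrA !poly_opD !poly_opMX IH poly_opC linD// linZ//.
by rewrite mulrC mul_polyC poly_opZ poly_opX.
Qed.

Lemma poly_opM P Q T x : linear T ->
  poly_op (P * Q) T x = poly_op P T (poly_op Q T x).
Proof.
move=> lT; elim/poly_ind: P Q x => [|P c IH] Q x.
  by rewrite mul0r -polyC0 !poly_opC !scale0r.
rewrite mulrDl -mulrA !poly_opD IH poly_opXM// poly_opMX poly_opC.
by rewrite mul_polyC poly_opZ.
Qed.

Lemma poly_op_bounded P T : bounded_op T -> bounded_op (poly_op P T).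
Proof.
move=> bT; apply: bounded_op_sum => i; apply: bounded_opZ.
exact: bounded_op_iter.
Qed.

End Poly.

Section RealPoly.
Context {R : realType} {H : completeNormedModType R[i]}.
Context (dot : {dot H for Num.conj}).
Context (dot_norm : forall x : H, dot x x = `|x| ^+ 2).
Local Notation ip := (rdot dot).
Local Notation selfadjoint := (selfadjoint dot).
Implicit Types (x y h : H) (T S A : H -> H) (P Q : {poly R}).

Definition rpoly_op P T : H -> H := poly_op (map_poly (real_complex R) P) T.

Lemma rpoly_opC c T x : rpoly_op c%:P T x = c%:C *: x.
Proof. by rewrite /rpoly_op map_polyC poly_opC. Qed.

Lemma rpoly_opX T x : rpoly_op 'X T x = T x.
Proof. by rewrite /rpoly_op map_polyX poly_opX. Qed.

Lemma rpoly_opD P Q T x : rpoly_op (P + Q) T x = rpoly_op P T x + rpoly_op Q T x.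
Proof. by rewrite /rpoly_op rmorphD poly_opD. Qed.

Lemma rpoly_opZ c P T x : rpoly_op (c *: P) T x = c%:C *: rpoly_op P T x.
Proof. by rewrite /rpoly_op map_polyZ poly_opZ. Qed.

Lemma rpoly_opM P Q T x : linear T -> rpoly_op (P * Q) T x = rpoly_op P T (rpoly_op Q T x).
Proof. by move=> lT; rewrite /rpoly_op rmorphM poly_opM. Qed.

Lemma rpoly_op_lin P T : linear T -> linear (rpoly_op P T).
Proof. exact: poly_op_lin. Qed.

Lemma rpoly_op_selfadjoint P T : selfadjoint T -> selfadjoint (rpoly_op P T).
Proof.
move=> [bT sT]; split=> [|x y]; first exact: poly_op_bounded.
have lT := bT.1; elim/poly_ind: P x y => [|P c IH] x y.
  by rewrite -polyC0 !rpoly_opC rdotZl rdotZr.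
rewrite !rpoly_opD !rpoly_opC rdotDl rdotDr rdotZl rdotZr; congr (_ + _).
by rewrite rpoly_opM// rpoly_opX IH sT -[T (rpoly_op P T y)]rpoly_opX -rpoly_opM// mulrC.
Qed.

Lemma rnorm_rpoly_op_sqr P T x : selfadjoint T ->
  rnorm (rpoly_op P T x) ^+ 2 = ip (rpoly_op (P * P) T x) x.
Proof.
move=> saT; have lT := saT.1.1.
by rewrite -(rdotxx dot_norm) rpoly_opM// (rpoly_op_selfadjoint P saT).2 rdotC.
Qed.

(** The imaginary part of <(T - z) x, x> is - Im z |x|^2, since <T x, x> is
    real. *)
Lemma below_imag T (z : R[i]) x : selfadjoint T ->
  `|complex.Im z| * rnorm x <= rnorm (T x - z *: x).
Proof.
move=> saT; have lT := saT.1.1; case: z => a b /=.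
have := rnorm_ge0 x; rewrite le_eqVlt => /orP[/eqP<-|x0].
  by rewrite mulr0 rnorm_ge0.
rewrite -(ler_pM2r x0).
have e : a +i* b = a%:C + b%:C * 'i%C by rewrite [LHS]complexE mulrC.
have h1 : ip (T x) ('i%C *: x) = 0.
  have : ip (T x) ('i%C *: x) = - ip (T x) ('i%C *: x).
    rewrite {1}saT.2 linZ// -{1}(rdotii dot x ('i%C *: _)) scalerA.
    have -> : 'i%C * 'i%C = (-1)%:C :> R[i] by rewrite -expr2 sqr_i rmorphN1.
    by rewrite rdotZr mulN1r rdotC.
  lra.
have h2 : ip x ('i%C *: x) = 0.
  have : ip x ('i%C *: x) = - ip x ('i%C *: x).
    rewrite {1}rdotC -{1}(rdotii dot _ x) scalerA.
    have -> : 'i%C * 'i%C = (-1)%:C :> R[i] by rewrite -expr2 sqr_i rmorphN1.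
    by rewrite rdotZl mulN1r.
  lra.
have : ip (T x - (a +i* b) *: x) ('i%C *: x) = - b * rnorm x ^+ 2.
  rewrite rdotBl h1 e scalerDl -scalerA rdotDl !rdotZl h2 rdotii (rdotxx dot_norm).
  by ring.
move=> h3; have := rdot_norm dot_norm (T x - (a +i* b) *: x) ('i%C *: x).
by rewrite h3 rnorm_i normrM normrN (ger0_norm (sqr_ge0 (rnorm x))) expr2 mulrA.
Qed.

Lemma below_real T (t : R) : bounded_op T -> ~ spectrum T t%:C ->
  bounded_below (T - t%:C *: id).
Proof.
move=> bT /contrapT[S [bS ST _]]; have [M M0 hM] := bounded_op_rnorm bS.
exists M^-1 => [|x]; first by rewrite invr_gt0.
rewrite ler_pdivrMl//; apply: le_trans (hM _).
by rewrite -[in leLHS](congr1 (@^~ x) ST : S _ = x).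
Qed.

(** Over the complex numbers P(T) is a product of factors T - z, with z a root
    of P.  Each of them is bounded below: by [below_imag] when z is not real,
    and because T - z is invertible when z is real and outside the spectrum. *)
Lemma bounded_below_roots P T : selfadjoint T -> P != 0 ->
  (forall t, spectrum T t%:C -> P.[t] != 0) -> bounded_below (rpoly_op P T).
Proof.
move=> saT P0 sP; have lT := saT.1.1.
have [s es] := closed_field_poly_normal (map_poly (real_complex R) P).
have c0 : lead_coef (map_poly (real_complex R) P) != 0.
  by rewrite lead_coef_eq0 map_poly_eq0.
move: (lead_coef _) es c0 => c es c0.
have rs (z : R[i]) : z \in s -> root (map_poly (real_complex R) P) z.
  by move=> zs; rewrite es rootZ// root_prod_XsubC.
have {rs} below (z : R[i]) : z \in s ->
    exists2 d : R, 0 < d & forall x, d * rnorm x <= rnorm (T x - z *: x).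
  move=> zs; have [im0|im0] := eqVneq (complex.Im z) 0; last first.
    by exists `|complex.Im z| => [|x]; [rewrite normr_gt0|exact: below_imag].
  have ez : z = (complex.Re z)%:C by rewrite [LHS]complexE im0 mulr0 addr0.
  rewrite ez; apply: below_real; first by case: saT.
  move=> /sP/eqP; apply; apply: complexI.
  by have := rs _ zs; rewrite ez /root horner_map => /eqP.
have [d d0 hd] : exists2 d : R, 0 < d & forall x,
    d * rnorm x <= rnorm (poly_op (\prod_(z <- s) ('X - z%:P)) T x).
  elim: s {es} below => [_|z s IH below].
    by exists 1 => // x; rewrite big_nil -polyC1 poly_opC scale1r mul1r.
  have [d d0 hd] := IH (fun (y : R[i]) ys => below y (mem_behead (s := z :: s) ys)).
  have [d' d'0 hd'] := below z (mem_head z s).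
  exists (d' * d) => [|x]; first exact: mulr_gt0.
  rewrite big_cons poly_opM// poly_opD poly_opX -polyCN poly_opC scaleNr.
  by apply: le_trans (hd' _); rewrite -mulrA ler_pM2l.
exists (complex.Re `|c| * d) => [|x].
  by rewrite mulr_gt0// -ltcR RRe_real ?normr_real ?normr_gt0.
by rewrite /rpoly_op es poly_opZ rnormZc -mulrA ler_wpM2l ?Re_norm_ge0.
Qed.

(** Writing B = A - m, the form <B x, x> is nonnegative, hence
    |B x|^2 <= L <B x, x>, and the right-hand side becomes arbitrarily small on
    the unit sphere: m is an approximate eigenvalue. *)
Lemma inf_form_not_below A : selfadjoint A -> (exists x, rnorm x = 1) ->
  ~ bounded_below (A - (inf [set ip (A x) x | x in [set x | rnorm x = 1]])%:C *: id).
Proof.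
move=> saA [x0 x01]; set E := [set _ | _ in _]; set m := inf E => -[d d0 hd].
have [bA sA] := saA; have [K K0 hK] := bounded_op_rnorm bA.
have hE : has_inf E.
  split; first by exists (ip (A x0) x0), x0.
  exists (- K) => _ [x /= x1 <-]; have := rdot_norm dot_norm (A x) x.
  rewrite ler_norml => /andP[h _]; apply: le_trans h.
  by rewrite lerN2 x1 mulr1; have := hK x; rewrite x1 mulr1.
have [bB sB] := selfadjointBc m saA.
set B := A - _ in bB sB hd; have [L L0 hL] := bounded_op_rnorm bB.
have lB := bB.1.
have BE x : ip (B x) x = ip (A x) x - m * rnorm x ^+ 2.
  by rewrite /B !fctE rdotBl rdotZl (rdotxx dot_norm).
clearbody B.
have posB x : 0 <= ip (B x) x.
  have := rnorm_ge0 x; rewrite le_eqVlt => /orP[/eqP/esym/rnorm_eq0->|xp].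
    by rewrite lin0// rdot0l.
  pose y : H := (rnorm x)^-1%:C *: x.
  have y1 : rnorm y = 1 by rewrite rnormZ ger0_norm ?invr_ge0 ?rnorm_ge0// mulVf ?gt_eqF.
  have : 0 <= ip (B y) y.
    rewrite BE y1 expr1n mulr1 subr_ge0; apply: ge_inf; first by case: hE.
    by exists y.
  rewrite linZ// rdotZl rdotZr; rewrite !pmulr_rge0 ?invr_gt0//.
have quad x : rnorm (B x) ^+ 2 <= L * ip (B x) x.
  have := posB (x - L^-1%:C *: B x).
  (* The form at x - B x / L, where L bounds the norm of B. *)
  rewrite (linB _ _ lB) (linZ _ _ lB) !(rdotBl, rdotBr, rdotZl, rdotZr).
  rewrite (sB (B x) x) (rdotxx dot_norm).
  have h : ip (B (B x)) (B x) <= L * rnorm (B x) ^+ 2.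
    apply: (le_trans (rdot_le dot_norm _ _)).
    by rewrite expr2 mulrA ler_wpM2r ?rnorm_ge0.
  move=> h1; have {}h1 : 0 <= ip (B x) x - 2 * L^-1 * rnorm (B x) ^+ 2
      + L^-1 ^+ 2 * ip (B (B x)) (B x).
    by apply: le_trans h1 _; rewrite le_eqVlt; apply/orP; left; apply/eqP; ring.
  have h2 : L^-1 ^+ 2 * ip (B (B x)) (B x) <= L^-1 * rnorm (B x) ^+ 2.
    rewrite expr2 -mulrA ler_pM2l ?invr_gt0//.
    by rewrite ler_pdivrMl.
  have : L^-1 * rnorm (B x) ^+ 2 <= ip (B x) x by lra.
  by rewrite ler_pdivrMl.
have [|_ [x /= x1 <-] hx] := @inf_adherent _ E (d ^+ 2 / L) _ hE.
  by rewrite divr_gt0// exprn_gt0.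
have := quad x; have := hd x; rewrite BE x1 expr1n !mulr1 => h1 h2.
have : L * (ip (A x) x - m) < d ^+ 2.
  by rewrite mulrC -ltr_pdivlMr// ltrBlDl.
move=> /(le_lt_trans h2); rewrite ltNge => /negP; apply.
by rewrite ler_pXn2r ?nnegrE ?rnorm_ge0 ?(ltW d0).
Qed.

Lemma spectrum_nonempty T : selfadjoint T -> (exists x, rnorm x = 1) ->
  exists t : R, spectrum T t%:C.
Proof.
move=> saT x1; apply: contrapT => nsp; apply: (inf_form_not_below saT x1).
set m := inf _.
have := @bounded_below_roots ('X - m%:P) T saT (negbT (polyXsubC_eq0 m)) _.
have -> : rpoly_op ('X - m%:P) T = T - m%:C *: id.
  by apply/funext => x; rewrite rpoly_opD rpoly_opX -polyCN rpoly_opC rmorphN scaleNr.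
by apply=> t spt; exfalso; apply: nsp; exists t.
Qed.

(** If the infimum m of the form of P(T) were negative, P - m would be positive
    on the spectrum, so [bounded_below_roots] would contradict
    [inf_form_not_below].  Nonemptiness of the spectrum excludes that P is the
    constant m. *)
Lemma rpoly_op_ge0 P T x : selfadjoint T ->
  (forall t, spectrum T t%:C -> 0 <= P.[t]) -> 0 <= ip (rpoly_op P T x) x.
Proof.
move=> saT hP; rewrite leNgt; apply/negP => neg.
have saP := rpoly_op_selfadjoint P saT; have lP := saP.1.1.
have xp : 0 < rnorm x.
  rewrite lt_neqAle rnorm_ge0 andbT eq_sym; apply/eqP => /rnorm_eq0 x0.
  by move: neg; rewrite x0 lin0// rdot0l ltxx.
pose y : H := (rnorm x)^-1%:C *: x.
have y1 : rnorm y = 1 by rewrite rnormZ ger0_norm ?invr_ge0 ?rnorm_ge0// mulVf ?gt_eqF.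
have ney : ip (rpoly_op P T y) y < 0.
  by rewrite linZ// rdotZl rdotZr !pmulr_rlt0 ?invr_gt0.
have u1 : exists x, rnorm x = 1 :> R by exists y.
have := inf_form_not_below saP u1; set E := [set _ | _ in _].
have : inf E < 0.
  apply: le_lt_trans ney; apply: ge_inf; last by exists y.
  have [K K0 hK] := bounded_op_rnorm saP.1.
  exists (- K) => _ [z /= z1 <-]; have := rdot_norm dot_norm (rpoly_op P T z) z.
  rewrite ler_norml => /andP[h _]; apply: le_trans h.
  by rewrite lerN2 z1 mulr1; have := hK z; rewrite z1 mulr1.
move: (inf E) => m m0; apply.
have -> : rpoly_op P T - m%:C *: id = rpoly_op (P - m%:P) T.
  by apply/funext => z; rewrite rpoly_opD -polyCN rpoly_opC rmorphN scaleNr.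
have pos t : spectrum T t%:C -> (P - m%:P).[t] != 0.
  by move=> /hP Pt; rewrite gt_eqF// hornerD hornerN hornerC subr_gt0 (lt_le_trans m0).
apply: bounded_below_roots => //; apply/eqP => Pm.
have [t /pos] := spectrum_nonempty saT u1.
by rewrite Pm horner0 eqxx.
Qed.

(** Positivity applied to e^2 - P^2. *)
Lemma rpoly_op_le P T (e : R) x : selfadjoint T -> 0 <= e ->
  (forall t, spectrum T t%:C -> `|P.[t]| <= e) -> rnorm (rpoly_op P T x) <= e * rnorm x.
Proof.
move=> saT e0 hP.
rewrite -(@ler_pXn2r _ 2) ?nnegrE ?mulr_ge0 ?rnorm_ge0// rnorm_rpoly_op_sqr//.
have := @rpoly_op_ge0 ((e ^+ 2)%:P - P * P) T x saT.
rewrite rpoly_opD rpoly_opC -[- (P * P)]scaleN1r rpoly_opZ rdotDl !rdotZl (rdotxx dot_norm) mulN1r.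
rewrite subr_ge0 exprMn; apply=> t /hP.
rewrite hornerD hornerC hornerZ hornerM mulN1r subr_ge0 -expr2.
by move=> h; rewrite -real_normK ?num_real// ler_pXn2r ?nnegrE.
Qed.

End RealPoly.

(** * Polynomial approximation of real powers *)

Section Bernstein.
Context {R : realType}.
Implicit Types (g h f : R -> R) (x y : R).

(** The Bernstein polynomial sum_i g(i) C(n,i) X^i (1-X)^(n-i), presented as the
    mean of g after n tosses of a coin of bias X by conditioning on one toss.
    This form makes monotonicity and the second moment immediate inductions. *)
Fixpoint bernstein n (g : nat -> R) : {poly R} :=
  if n is n'.+1 then
    'X * bernstein n' (fun i => g i.+1) + (1 - 'X) * bernstein n' g
  else (g 0)%:P.

Lemma bernsteinS n (g : nat -> R) x : (bernstein n.+1 g).[x] =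
  x * (bernstein n (fun i => g i.+1)).[x] + (1 - x) * (bernstein n g).[x].
Proof. by rewrite /= hornerD !hornerM hornerD hornerN hornerX hornerC. Qed.

Lemma bernstein_le n (g h : nat -> R) x : 0 <= x <= 1 ->
  (forall i, (i <= n)%N -> g i <= h i) -> (bernstein n g).[x] <= (bernstein n h).[x].
Proof.
move=> /andP[x0 x1]; elim: n g h => [|n IH] g h gh.
  by rewrite /= !hornerC gh.
rewrite !bernsteinS; apply: lerD; rewrite ler_wpM2l ?subr_ge0//; apply: IH => i ni.
  exact: gh.
exact/gh/leqW.
Qed.

(** Second moment of the binomial law: variance plus squared bias. *)
Lemma bernstein_sqr n (a b c x : R) :
  (bernstein n (fun i => a + b * (i%:R - c) ^+ 2)).[x] =
  a + b * (n%:R * (x * (1 - x)) + (n%:R * x - c) ^+ 2).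
Proof.
elim: n c => [|n IH] c; first by rewrite /= hornerC mulr0n !mul0r !add0r.
rewrite bernsteinS IH.
have -> : (fun i : nat => a + b * (i.+1%:R - c) ^+ 2) =
          (fun i : nat => a + b * (i%:R - (c - 1)) ^+ 2).
  by apply/funext => i; rewrite opprB addrA -natr1.
by rewrite IH -natr1; ring.
Qed.

(** The hypothesis is uniform continuity in quadratic form, so that the error
    at t is at most e/2 plus C times the variance t(1-t)/n of the nodes. *)
Lemma bernstein_approx f :
  (forall e : R, 0 < e -> exists C : R, forall x y : R, 0 <= x <= 1 -> 0 <= y <= 1 ->
     `|f x - f y| <= e + C * (x - y) ^+ 2) ->
  forall e : R, 0 < e -> exists P : {poly R}, forall t : R, 0 <= t <= 1 ->
    `|P.[t] - f t| <= e.
Proof.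
move=> hf e e0; have [C hC] := hf (e / 2) ltac:(by rewrite divr_gt0).
have e20 : 0 < e / 2 / (`|C| + 1) by rewrite !divr_gt0// ltr_wpDl.
have [N hN] := ltr_add_invr e20.
rewrite add0r in hN; pose n := N.+1; have n0 : (n%:R : R) != 0 by rewrite pnatr_eq0.
(* n is chosen so that |C| / n <= e / 2. *)
exists (bernstein n (fun i => f (i%:R / n%:R))) => t t01.
have node i : (i <= n)%N -> 0 <= (i%:R / n%:R : R) <= 1.
  move=> ni; have -> : 0 <= (i%:R / n%:R : R) by rewrite divr_ge0.
  by rewrite ler_pdivrMr ?ltr0n// mul1r ler_nat.
have tt : 0 <= t * (1 - t) <= 1.
  by case/andP: t01 => t0 t1; nra.
have small : `|C| / n%:R * (t * (1 - t)) <= e / 2.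
  case/andP: tt => tt0 tt1.
  apply: (@le_trans _ _ (`|C| / n%:R)); first by rewrite ler_piMr// divr_ge0.
  rewrite mulrC; apply: (@le_trans _ _ (n%:R^-1 * (`|C| + 1))).
    by rewrite ler_pM2l ?invr_gt0 ?ltr0n// lerDl.
  by rewrite -ler_pdivlMr ?ltr_wpDl// ltW.
have bound b : (bernstein n (fun i => (f t + b * (e / 2)) +
    b * `|C| / n%:R ^+ 2 * (i%:R - n%:R * t) ^+ 2)).[t] =
    f t + b * (e / 2 + `|C| / n%:R * (t * (1 - t))).
  by rewrite bernstein_sqr; field.
have close i : (i <= n)%N -> `|f t - f (i%:R / n%:R)| <=
    e / 2 + `|C| / n%:R ^+ 2 * (i%:R - n%:R * t) ^+ 2.
  move=> /node ni; apply: (le_trans (hC _ _ t01 ni)); rewrite lerD2l.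
  have -> : `|C| / n%:R ^+ 2 * (i%:R - n%:R * t) ^+ 2 =
      `|C| * (t - i%:R / n%:R) ^+ 2 by field.
  by rewrite ler_wpM2r ?sqr_ge0// ler_norm.
rewrite ler_norml; apply/andP; split.
  rewrite lerBrDr; apply: (@le_trans _ _ (f t + -1 * (e / 2 + `|C| / n%:R * (t * (1 - t))))).
    by move: small; set z := (_ / _ * _); lra.
  rewrite -bound; apply: bernstein_le => // i /close; rewrite ler_norml => /andP[_].
  by set z := _ - _ * t; set w := f (i%:R / _); rewrite !mulN1r !mulNr; lra.
rewrite lerBlDr; apply: (@le_trans _ _ (f t + 1 * (e / 2 + `|C| / n%:R * (t * (1 - t))))).
  rewrite -bound; apply: bernstein_le => // i /close; rewrite ler_norml => /andP[+ _].
  by set z := _ - _ * t; set w := f (i%:R / _); rewrite !mul1r; lra.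
by move: small; set z := (_ / _ * _); lra.
Qed.

(** Young's inequality for t and a^(s-1) with exponents s and s/(s-1). *)
Lemma powR_tangent (s a t : R) : 1 <= s -> 0 < a -> 0 <= t ->
  a `^ s + s * a `^ (s - 1) * (t - a) <= t `^ s.
Proof.
move=> s1 a0 t0.
have sp : 0 < s by rewrite (lt_le_trans ltr01).
have aE : a `^ (s - 1) * a = a `^ s.
  rewrite -{2}(powRr1 (ltW a0)) -powRD ?subrK//.
  by rewrite (gt_eqF a0) implybT.
move: s1; rewrite le_eqVlt => /orP[/eqP<-|s1].
  by rewrite subrr powRr0 !powRr1 ?(ltW a0)// !mul1r addrC subrK.
have s10 : 0 < s - 1 by rewrite subr_gt0.
have sn0 : s != 0 by rewrite gt_eqF.
have s1n0 : s - 1 != 0 by rewrite gt_eqF.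
have := @conjugate_powR _ t (a `^ (s - 1)) s (s / (s - 1)) t0 (powR_ge0 _ _) sp
  (divr_gt0 sp s10).
have -> : s^-1 + (s / (s - 1))^-1 = 1 by field; rewrite s1n0.
move=> /(_ erefl); rewrite -powRrM.
have -> : (s - 1) * (s / (s - 1)) = s by field; rewrite s1n0.
rewrite -(ler_pM2l sp).
have -> : s * (t `^ s / s + a `^ s / (s / (s - 1))) = t `^ s + (s - 1) * a `^ s.
  by field; rewrite sn0 s1n0.
rewrite -aE; lra.
Qed.

Lemma powR_lip (s x y : R) : 1 <= s -> 0 <= x <= 1 -> 0 <= y <= 1 ->
  `|x `^ s - y `^ s| <= s * `|x - y|.
Proof.
move=> s1; wlog xy : x y / y <= x => [wl x01 y01|/andP[x0 x1] /andP[y0 y1]].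
  have [/wl->//|/ltW/wl h] := leP y x.
  by rewrite distrC (distrC x) h.
have s0 : 0 <= s by rewrite (le_trans ler01).
rewrite !ger0_norm ?subr_ge0//; last by rewrite ge0_ler_powR.
have := x0; rewrite le_eqVlt => /orP[/eqP x00|xp].
  by rewrite (_ : y = x) ?subrr ?mulr0//; apply/le_anti; rewrite xy -x00 y0.
have := powR_tangent s1 xp y0.
have : s * x `^ (s - 1) * (x - y) <= s * (x - y).
  rewrite ler_wpM2r ?subr_ge0// ler_piMr//.
  have : x `^ (s - 1) <= 1 `^ (s - 1) by rewrite ge0_ler_powR ?nnegrE ?subr_ge0.
  by rewrite powR1.
lra.
Qed.

Lemma sqrt_holder (x y : R) : 0 <= x -> 0 <= y ->
  (Num.sqrt x - Num.sqrt y) ^+ 2 <= `|x - y|.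
Proof.
move=> x0 y0; rewrite -[in leRHS](sqr_sqrtr x0) -[in leRHS](sqr_sqrtr y0).
have := sqrtr_ge0 x; have := sqrtr_ge0 y; move: (Num.sqrt x) (Num.sqrt y) => u v v0 u0.
rewrite subr_sqr normrM -real_normK ?num_real// expr2 ler_wpM2l//.
rewrite (ger0_norm (addr_ge0 u0 v0)) ler_norml; lra.
Qed.

(** Square roots are Hoelder continuous and the powers s >= 1 are Lipschitz on
    [0, 1]; both have a modulus of continuity of the quadratic form required by
    [bernstein_approx].  The interval [0, M] is rescaled to [0, 1]. *)
Lemma powR_approx (s M e : R) : s = 2^-1 \/ 1 <= s -> 0 < M -> 0 < e ->
  exists P : {poly R}, forall t : R, 0 <= t <= M -> `|P.[t] - t `^ s| <= e.
Proof.
move=> hs M0 e0; have Ms0 : 0 < M `^ s by rewrite powR_gt0.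
have hf : forall e : R, 0 < e -> exists C : R, forall x y : R, 0 <= x <= 1 -> 0 <= y <= 1 ->
     `|x `^ s - y `^ s| <= e + C * (x - y) ^+ 2.
  move=> {e0}e e0; case: hs => [->|s1].
    exists (e ^- 3) => x y /andP[x0 _] /andP[y0 _].
    rewrite !powR12_sqrt//; have := sqrt_holder x0 y0.
    rewrite -real_normK ?num_real//; set a := `|_ - _| => h.
    have a0 : 0 <= a by exact: normr_ge0.
    have [ae|ea] := leP a e.
      by rewrite ler_wpDr// mulr_ge0 ?sqr_ge0// invr_ge0 exprn_ge0// ltW.
    rewrite ler_wpDl//; first exact: ltW.
    rewrite ler_pdivlMl ?exprn_gt0// -real_normK ?num_real//.
    apply: (@le_trans _ _ ((a ^+ 2) ^+ 2)); last by rewrite ler_pXn2r ?nnegrE ?sqr_ge0.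
    have -> : (a ^+ 2) ^+ 2 = a ^+ 3 * a by ring.
    by rewrite ler_wpM2r// ler_pXn2r ?nnegrE ?(ltW e0) ?(ltW ea).
  exists (s ^+ 2 / (4 * e)) => x y x01 y01; apply: (le_trans (powR_lip s1 x01 y01)).
  rewrite -[(x - y) ^+ 2]real_normK ?num_real//; move: (`|_|) => d.
  rewrite -subr_ge0.
  have -> : e + s ^+ 2 / (4 * e) * d ^+ 2 - s * d = (2 * e - s * d) ^+ 2 / (4 * e).
    by field; rewrite gt_eqF.
  by rewrite divr_ge0 ?sqr_ge0// mulr_ge0// ltW.
have [P hP] := bernstein_approx hf (divr_gt0 e0 Ms0).
exists (M `^ s *: (P \Po (M^-1 *: 'X))) => t /andP[t0 tM].
rewrite hornerZ horner_comp hornerZ hornerX.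
have t01 : 0 <= M^-1 * t <= 1.
  by rewrite mulr_ge0 ?invr_ge0 ?(ltW M0)//= ler_pdivrMl// mulr1.
have {1}-> : t `^ s = M `^ s * (M^-1 * t) `^ s.
  rewrite -powRM ?(ltW M0)//; last by case/andP: t01.
  by rewrite mulrA divff ?mul1r// gt_eqF.
rewrite -mulrBr normrM gtr0_norm// mulrC -ler_pdivlMr//; exact: hP.
Qed.

End Bernstein.

(** * The continuous functional calculus *)

Section Calculus.
Context {R : realType} {H : completeNormedModType R[i]}.
Context (dot : {dot H for Num.conj}).
Context (dot_norm : forall x : H, dot x x = `|x| ^+ 2).
Local Notation ip := (rdot dot).
Local Notation selfadjoint := (selfadjoint dot).
Implicit Types (x y h : H) (T S A F G : H -> H) (P Q : {poly R}) (f g : R -> R).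

(** A form of [is_calculus] with real polynomials and pointwise operator
    estimates, from which the order properties can be read off. *)
Definition real_calculus f T S := bounded_op S /\
  forall e : R, 0 < e -> exists P : {poly R},
    (forall t : R, spectrum T t%:C -> `|P.[t] - f t| <= e) /\
    forall x, rnorm (rpoly_op P T x - S x) <= e * rnorm x.

(** If P approximates a real function on the spectrum, so does its real part,
    and its imaginary part is small there, hence small at T by
    [rpoly_op_le]. *)
Lemma is_calculus_real f T S : selfadjoint T ->
  is_calculus f T S -> real_calculus f T S.
Proof.
move=> saT [bS hS]; split=> // e e0.
have [P [hP PS]] := hS (e / 2) (divr_gt0 e0 (ltr0n _ 2)).
pose P1 := map_poly (@complex.Re R) P; pose P2 := map_poly (@complex.Im R) P.
have PE : P = map_poly (real_complex R) P1 + 'i%C *: map_poly (real_complex R) P2.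
  apply/polyP => i; rewrite coefD coefZ !coef_map_id0//=.
  exact: complexE.
have PT t : P.[t%:C] = P1.[t]%:C + 'i%C * (P2.[t])%:C.
  by rewrite PE hornerD hornerZ !horner_map.
have h12 t : spectrum T t%:C -> `|P1.[t] - f t| <= e / 2 /\ `|P2.[t]| <= e / 2.
  move=> /hP; rewrite PT normc_def lecR/= !(mul0r, mul1r, add0r, subr0, addr0) => h.
  split; apply: le_trans h; rewrite -sqrtr_sqr ler_wsqrtr// ?lerDl ?lerDr ?sqr_ge0//.
exists P1; split=> [t /h12[h _]|x]; first by apply: (le_trans h); lra.
have -> : rpoly_op P1 T x - S x = (poly_op P T - S) x - 'i%C *: rpoly_op P2 T x.
  by rewrite !fctE PE poly_opD poly_opZ /rpoly_op -addrA [- _ - _]addrC addrA addrK.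
apply: (le_trans (rnormD _ _)); rewrite rnormN rnorm_i [e]splitr mulrDl lerD//.
  apply: (le_trans (opnorm_ge _ _)); last by rewrite ler_wpM2r ?rnorm_ge0.
  apply: bounded_opD; first by apply: poly_op_bounded; case: saT.
  by rewrite -scaleN1r; apply: bounded_opZ.
apply: (rpoly_op_le dot_norm _ saT); first by rewrite divr_ge0 ?(ltW e0).
by move=> t /h12[].
Qed.

Lemma le0_of_harmonic (u c : R) : (forall n : nat, u <= n.+1%:R^-1 * c) -> u <= 0.
Proof.
move=> h; rewrite leNgt; apply/negP => u0.
have c0 : 0 <= `|c| + 1 by rewrite ltW// ltr_wpDl.
have [n] := @ltr_add_invr _ 0 (u / (`|c| + 1)) ltac:(by rewrite divr_gt0// ltr_wpDl).
rewrite add0r ltr_pdivlMr ?ltr_wpDl// ltNge => /negP; apply.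
apply: (le_trans (h n)); rewrite ler_pM2l ?invr_gt0//.
by rewrite (le_trans (ler_norm c))// lerDl.
Qed.

(** By [rpoly_op_le], polynomials that converge uniformly on the spectrum give
    a Cauchy sequence of operators. *)
Lemma calculus_exists f T : selfadjoint T ->
  (forall e : R, 0 < e -> exists P : {poly R}, forall t : R,
     spectrum T t%:C -> `|P.[t] - f t| <= e) ->
  exists S, is_calculus f T S.
Proof.
move=> saT hf; have lT := saT.1.1.
have /choice[P hP] : forall n : nat, exists P : {poly R}, forall t : R,
     spectrum T t%:C -> `|P.[t] - f t| <= n.+1%:R^-1.
  by move=> n; apply: hf; rewrite invr_gt0.
have cauchy n m x : rnorm (rpoly_op (P n) T x - rpoly_op (P m) T x) <=
    n.+1%:R^-1 * rnorm x + m.+1%:R^-1 * rnorm x.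
  have -> : rpoly_op (P n) T x - rpoly_op (P m) T x = rpoly_op (P n - P m) T x.
    by rewrite rpoly_opD -[in RHS](scaleN1r (P m)) rpoly_opZ rmorphN1 scaleN1r.
  rewrite -mulrDl; apply: (rpoly_op_le dot_norm _ saT); first by rewrite addr_ge0.
  move=> t st; rewrite hornerD hornerN.
  have -> : (P n).[t] - (P m).[t] = ((P n).[t] - f t) - ((P m).[t] - f t) by ring.
  by apply: (le_trans (ler_normB _ _)); rewrite lerD ?hP.
have small (c e : R) : 0 < e -> exists N, forall n, (N <= n)%N -> n.+1%:R^-1 * c <= e.
  move=> e0; have c0 : 0 < `|c| + 1 by rewrite ltr_wpDl.
  have [N hN] := @ltr_add_invr _ 0 (e / (`|c| + 1)) (divr_gt0 e0 c0).
  exists N => n Nn; rewrite add0r in hN.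
  apply: (@le_trans _ _ (n.+1%:R^-1 * (`|c| + 1))).
    by rewrite ler_pM2l ?invr_gt0// (le_trans (ler_norm c))// lerDl.
  rewrite -ler_pdivlMr//; apply: ltW; apply: le_lt_trans hN.
  by rewrite lef_pV2 ?posrE// ler_nat.
have /choice[S hS] x : exists l, forall e : R, 0 < e -> exists N, forall n, (N <= n)%N ->
     rnorm (rpoly_op (P n) T x - l) <= e.
  apply: rnorm_complete => e e0; have [N hN] := small (rnorm x) (e / 2) ltac:(by rewrite divr_gt0).
  exists N => n m Nn Nm; rewrite [e]splitr.
  by apply: (le_trans (cauchy _ _ _)); rewrite lerD// hN.
have rate n x : rnorm (rpoly_op (P n) T x - S x) <= n.+1%:R^-1 * rnorm x.
  apply/ler_addgt0Pr => e e0.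
  have [N hN] := small (rnorm x) (e / 2) ltac:(by rewrite divr_gt0).
  have [N' hN'] := hS x (e / 2) ltac:(by rewrite divr_gt0).
  pose m := maxn N N'.
  have -> : rpoly_op (P n) T x - S x =
      (rpoly_op (P n) T x - rpoly_op (P m) T x) + (rpoly_op (P m) T x - S x).
    by rewrite addrA subrK.
  apply: (le_trans (rnormD _ _)).
  have := cauchy n m x; have := hN m (leq_maxl _ _); have := hN' m (leq_maxr _ _).
  by move: (_ * rnorm x) (_ * rnorm x) => u v; lra.
have lS : linear S.
  move=> a x y; apply/eqP; rewrite -subr_eq0; apply/eqP/rnorm_eq0/le_anti.
  rewrite rnorm_ge0 andbT.
  apply: (@le0_of_harmonic _ (rnorm (a *: x + y) + complex.Re `|a| * rnorm x + rnorm y)) => n.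
  have -> : S (a *: x + y) - (a *: S x + S y) =
     (a *: (rpoly_op (P n) T x - S x) + (rpoly_op (P n) T y - S y))
     - (rpoly_op (P n) T (a *: x + y) - S (a *: x + y)).
    rewrite rpoly_op_lin// scalerBr addrACA -opprD opprB.
    by rewrite [RHS]addrC [RHS]addrA subrK.
  apply: (le_trans (rnormD _ _)); rewrite rnormN -[X in _ * X]addrA mulrDr [leLHS]addrC lerD//.
  apply: (le_trans (rnormD _ _)); rewrite mulrDr; apply: lerD => //.
  by rewrite rnormZc mulrCA ler_wpM2l ?Re_norm_ge0.
have bS : bounded_op S.
  have [K K0 hK] := bounded_op_rnorm (rpoly_op_selfadjoint (P 0) saT).1.
  apply: (@rnorm_bounded_op _ _ _ (K + 1)) => // x.
  have -> : S x = rpoly_op (P 0) T x - (rpoly_op (P 0) T x - S x) by rewrite opprB addrC subrK.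
  apply: (le_trans (rnormD _ _)); rewrite rnormN mulrDl lerD//.
  by rewrite -[X in X * _]invr1; apply: rate.
exists S; split=> // e e0; have [n hn] := @ltr_add_invr _ 0 e e0.
rewrite add0r in hn; exists (map_poly (real_complex R) (P n)); split=> [t st|].
  rewrite horner_map/= -rmorphB normc_def/= expr0n addr0 sqrtr_sqr lecR.
  by apply: (le_trans (hP n t st)); apply: ltW.
apply: opnorm_le => [x|]; last exact: ltW.
rewrite !fctE; apply: (le_trans (rate n x)).
by rewrite ler_wpM2r ?rnorm_ge0 ?(ltW hn).
Qed.

Lemma real_calculus_poly P T : bounded_op T -> real_calculus (horner P) T (rpoly_op P T).
Proof.
move=> bT; split=> [|e e0]; first exact: poly_op_bounded.
exists P; split=> [t _|x]; first by rewrite subrr normr0 ltW.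
by rewrite subrr rnorm0 mulr_ge0 ?rnorm_ge0 ?(ltW e0).
Qed.

Lemma real_calculus_lin f g T F G (a b : R) :
  real_calculus f T F -> real_calculus g T G ->
  real_calculus (fun t => a * f t + b * g t) T (a%:C *: F + b%:C *: G).
Proof.
move=> [bF hF] [bG hG]; split=> [|e e0].
  by apply: bounded_opD; apply: bounded_opZ.
pose d := e / (`|a| + `|b| + 1).
have ab : 0 < `|a| + `|b| + 1 by rewrite ltr_wpDl// addr_ge0.
have d0 : 0 < d by rewrite divr_gt0.
have dE : `|a| * d + `|b| * d <= e.
  rewrite -mulrDl mulrC /d mulrAC ler_pdivrMr// ler_pM2l// lerDl//.
clearbody d.
have [P [hP PF]] := hF d d0; have [Q [hQ QG]] := hG d d0.
exists (a *: P + b *: Q); split=> [t st|x].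
  rewrite hornerD !hornerZ; apply: le_trans dE.
  have -> : a * P.[t] + b * Q.[t] - (a * f t + b * g t) =
     a * (P.[t] - f t) + b * (Q.[t] - g t) by ring.
  apply: (le_trans (ler_normD _ _)); rewrite !normrM lerD//.
    by rewrite ler_wpM2l// hP.
  by rewrite ler_wpM2l// hQ.
rewrite !fctE rpoly_opD !rpoly_opZ.
have -> : a%:C *: rpoly_op P T x + b%:C *: rpoly_op Q T x - (a%:C *: F x + b%:C *: G x) =
  a%:C *: (rpoly_op P T x - F x) + b%:C *: (rpoly_op Q T x - G x).
  by rewrite !scalerBr opprD addrACA.
apply: (le_trans (rnormD _ _)); rewrite !rnormZ.
apply: (@le_trans _ _ ((`|a| * d + `|b| * d) * rnorm x)); last by rewrite ler_wpM2r ?rnorm_ge0.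
by rewrite mulrDl -!mulrA; apply: lerD; rewrite ler_wpM2l ?PF ?QG.
Qed.

Lemma real_calculus_ge0 f T F x : selfadjoint T -> real_calculus f T F ->
  (forall t, spectrum T t%:C -> 0 <= f t) -> 0 <= ip (F x) x.
Proof.
move=> saT [bF hF] f0; apply/ler_addgt0Pr => e e0.
pose c := 2 * rnorm x ^+ 2 + 1.
have c0 : 0 < c by rewrite ltr_wpDl// mulr_ge0// sqr_ge0.
have [P [hP PF]] := hF (e / c) (divr_gt0 e0 c0).
have := @rpoly_op_ge0 _ _ _ dot_norm (P + (e / c)%:P) T x saT.
have Pt t : spectrum T t%:C -> 0 <= (P + (e / c)%:P).[t].
  move=> st; have := f0 t st; have := hP t st.
  by rewrite ler_norml hornerD hornerC => /andP[]; lra.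
move=> /(_ Pt); rewrite rpoly_opD rpoly_opC rdotDl rdotZl (rdotxx dot_norm) => h.
have := rdot_le dot_norm (rpoly_op P T x - F x) x; rewrite rdotBl => h2.
have h3 : rnorm (rpoly_op P T x - F x) * rnorm x <= e / c * rnorm x ^+ 2.
  by rewrite expr2 mulrA ler_wpM2r ?rnorm_ge0.
have : e / c * (2 * rnorm x ^+ 2 + 1) = e by rewrite divfK// gt_eqF.
have : 0 < e / c by rewrite divr_gt0.
by move: (e / c) h h2 h3 => d *; lra.
Qed.

Lemma real_calculus_eq f g T F G x : selfadjoint T ->
  real_calculus f T F -> real_calculus g T G ->
  (forall t, spectrum T t%:C -> f t = g t) -> ip (F x) x = ip (G x) x.
Proof.
move=> saT cF cG fg.
have h a b : a + b = 0 -> 0 <= a * ip (F x) x + b * ip (G x) x.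
  move=> ab; rewrite -!rdotZl -rdotDl.
  apply: (real_calculus_ge0 x saT (real_calculus_lin a b cF cG)) => t /fg ->.
  by rewrite -mulrDl ab mul0r.
have := h 1 (-1) (subrr _); have := h (-1) 1 (addNr _); lra.
Qed.

Lemma real_calculus_selfadjoint f T F : selfadjoint T -> real_calculus f T F ->
  selfadjoint F.
Proof.
move=> saT [bF hF]; split=> // x y; apply/eqP; rewrite -subr_eq0 -normr_le0.
apply/ler_addgt0Pr => e e0; rewrite add0r.
pose c := 2 * (rnorm x * rnorm y) + 1.
have c0 : 0 < c by rewrite ltr_wpDl// !mulr_ge0// rnorm_ge0.
have [P [hP PF]] := hF (e / c) (divr_gt0 e0 c0).
have e1 : e / c * (2 * (rnorm x * rnorm y) + 1) = e by rewrite divfK// gt_eqF.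
have ec : 0 < e / c by rewrite divr_gt0.
have -> : ip (F x) y - ip x (F y) =
    ip x (rpoly_op P T y - F y) - ip (rpoly_op P T x - F x) y.
  by rewrite rdotBr rdotBl (rpoly_op_selfadjoint P saT).2; ring.
apply: (le_trans (ler_normB _ _)).
have h1 := rdot_norm dot_norm x (rpoly_op P T y - F y).
have h2 := rdot_norm dot_norm (rpoly_op P T x - F x) y.
have h3 : rnorm x * rnorm (rpoly_op P T y - F y) <= e / c * (rnorm x * rnorm y).
  by rewrite mulrCA ler_wpM2l ?rnorm_ge0.
have h4 : rnorm (rpoly_op P T x - F x) * rnorm y <= e / c * (rnorm x * rnorm y).
  by rewrite mulrA ler_wpM2r ?rnorm_ge0.
by move: (e / c) (rnorm x * rnorm y) h1 h2 h3 h4 ec e1 => d z *; lra.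
Qed.

Lemma real_calculus_sqr f T F (B : R) : selfadjoint T -> real_calculus f T F ->
  (forall t, spectrum T t%:C -> `|f t| <= B) ->
  real_calculus (fun t => f t ^+ 2) T (F \o F).
Proof.
move=> saT cF fB; have [bF hF] := cF; split=> [|e e0].
  exact: bounded_op_comp.
have lT := saT.1.1.
have [K K0 hK] := bounded_op_rnorm bF.
pose c := 2 * `|B| + 1 + K.
have c0 : 0 < c by rewrite ltr_wpDr ?(ltW K0)// ltr_wpDl// mulr_ge0.
pose d := Num.min 1 (e / c).
have d0 : 0 < d by rewrite lt_min ltr01 divr_gt0.
have d1 : d <= 1 by rewrite ge_min lexx.
have dc : d * c <= e by rewrite -ler_pdivlMr// ge_min lexx orbT.
have [P [hP PF]] := hF d d0.
have fB' t : spectrum T t%:C -> `|f t| <= `|B|.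
  by move=> st; apply: le_trans (fB t st) (ler_norm _).
have PB t : spectrum T t%:C -> `|P.[t]| <= `|B| + d.
  move=> st; rewrite -[P.[t]](subrK (f t)) addrC.
  by apply: (le_trans (ler_normD _ _)); rewrite lerD ?hP ?fB'.
exists (P * P); split=> [t st|x].
  rewrite hornerM -expr2 subr_sqr normrM.
  apply: (@le_trans _ _ (d * c)) => //; apply: ler_pM => //; first exact: hP.
  apply: (le_trans (ler_normD _ _)); rewrite /c.
  have := PB t st; have := fB' t st; lra.
rewrite rpoly_opM//=.
have -> : rpoly_op P T (rpoly_op P T x) - F (F x) =
    rpoly_op P T (rpoly_op P T x - F x) + (rpoly_op P T (F x) - F (F x)).
  by rewrite [rpoly_op P T (_ - _)]linB ?addrA ?subrK//; apply: rpoly_op_lin.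
apply: (le_trans (rnormD _ _)).
have h1 : rnorm (rpoly_op P T (rpoly_op P T x - F x)) <= (`|B| + d) * (d * rnorm x).
  apply: (le_trans (rpoly_op_le dot_norm _ saT _ PB)); first by rewrite addr_ge0// ltW.
  by rewrite ler_wpM2l// addr_ge0// ltW.
have h2 : rnorm (rpoly_op P T (F x) - F (F x)) <= d * (K * rnorm x).
  by apply: (le_trans (PF _)); rewrite ler_wpM2l// ltW.
apply: (le_trans (lerD h1 h2)).
have -> : (`|B| + d) * (d * rnorm x) + d * (K * rnorm x) = d * (`|B| + d + K) * rnorm x by ring.
rewrite ler_wpM2r ?rnorm_ge0//; apply: le_trans dc; rewrite ler_wpM2l ?(ltW d0)// /c.
have := normr_ge0 B; lra.
Qed.

(** McCarthy's inequality: g lies above the tangent line of t^s at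
    a = <F x, x>, composed with f; since the calculus preserves order and |x| = 1,
    evaluating this line at <F x, x> gives a^s. *)
Lemma real_calculus_jensen f g T F G (s : R) x : selfadjoint T -> 1 <= s ->
  real_calculus f T F -> real_calculus g T G ->
  (forall t, spectrum T t%:C -> 0 <= f t) ->
  (forall t, spectrum T t%:C -> g t = f t `^ s) ->
  rnorm x = 1 -> ip (F x) x `^ s <= ip (G x) x.
Proof.
move=> saT s1 cF cG f0 gf x1.
have := real_calculus_ge0 x saT cF f0; rewrite le_eqVlt => /orP[/eqP<-|a0].
  rewrite powR0 ?gt_eqF ?(lt_le_trans ltr01)//.
  by apply: (real_calculus_ge0 x saT cG) => t /gf ->; apply: powR_ge0.
set a := ip (F x) x in a0 *.
pose b := s * a `^ (s - 1).
have c1 := real_calculus_lin 1 (- b) cG cF.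
have c2 := real_calculus_lin 1 1 c1 (real_calculus_poly (b * a - a `^ s)%:P saT.1).
have := real_calculus_ge0 x saT c2.
rewrite !fctE rpoly_opC !rdotDl !rdotZl !rdotDl !rdotZl (rdotxx dot_norm) x1 -/a expr1n !mul1r mulr1.
suff h : forall t, spectrum T t%:C ->
    0 <= 1 * (1 * g t + - b * f t) + 1 * (b * a - a `^ s)%:P.[t].
  by move=> /(_ h); lra.
move=> t st; have := powR_tangent s1 a0 (f0 t st); rewrite -/b hornerC (gf t st).
by lra.
Qed.

(** For a positive operator the spectrum lies in some [0, M], where t^s is a
    uniform limit of polynomials; hence the operator chosen by [op_power] is a
    genuine value of the calculus. *)
Lemma op_power_calculus T (s : R) : selfadjoint T ->
  (forall x, 0 <= ip (T x) x) -> s = 2^-1 \/ 1 <= s ->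
  real_calculus (fun t => t `^ s) T (op_power T s) /\
  exists M : R, forall t, spectrum T t%:C -> 0 <= t <= M.
Proof.
move=> saT pT hs; have [M M0 hM] := bounded_op_rnorm saT.1.
have sp t : spectrum T t%:C -> 0 <= t <= M.
  apply: (spectrum_pos dot_norm saT pT) => x.
  apply: (le_trans (rdot_le dot_norm _ _)).
  by rewrite expr2 mulrA ler_wpM2r ?rnorm_ge0.
split; last by exists M.
apply: (is_calculus_real saT); rewrite /op_power /calculus; set E := [set S | _].
have : E (xget 0 E) by apply: (@xgetPex _ 0 E); apply: calculus_exists => // e e0;
  have [P hP] := powR_approx hs M0 e0; exists P => t /sp; apply: hP.
by [].
Qed.

(** The square of |T| is T^* T because the squared square root is the identity
    on the spectrum; so |T| x and T x have the same norm. *)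
Lemma op_abs_spec T : bounded_op T ->
  [/\ selfadjoint (op_abs dot T), forall x, 0 <= ip (op_abs dot T x) x &
      forall x, rnorm (op_abs dot T x) = rnorm (T x)].
Proof.
move=> bT; have [bT' aT] := adjoint_spec dot_norm bT.
have rdotT x y : ip ((adjoint dot T \o T) x) y = ip (T x) (T y).
  by rewrite /= [RHS]rdotC rdotC /rdot aT.
have sa : selfadjoint (adjoint dot T \o T).
  split; first exact: bounded_op_comp.
  by move=> x y; rewrite rdotT rdotC -rdotT rdotC.
have [|cal [M hM]] := op_power_calculus sa _ (or_introl (erefl 2^-1)).
  by move=> x; rewrite rdotT (rdotxx dot_norm) sqr_ge0.
have saX := real_calculus_selfadjoint sa cal.
split=> //.
  by move=> x; apply: (real_calculus_ge0 x sa cal) => t _; apply: powR_ge0.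
move=> x; apply/eqP; rewrite -(@eqrXn2 _ 2) ?rnorm_ge0// -!(rdotxx dot_norm) -rdotT.
rewrite -[ip (op_abs _ _ _) _](saX.2).
have bnd t : spectrum (adjoint dot T \o T) t%:C -> `|t `^ 2^-1| <= M `^ 2^-1.
  move=> /hM/andP[t0 tM]; rewrite ger0_norm ?powR_ge0//.
  by rewrite ge0_ler_powR ?nnegrE ?invr_ge0// (le_trans t0).
rewrite -[(adjoint dot T \o T) x]rpoly_opX; apply/eqP.
apply: (real_calculus_eq x sa (real_calculus_sqr sa cal bnd)
  (real_calculus_poly 'X sa.1)).
  by move=> t /hM/andP[t0 _]; rewrite hornerX powR12_sqrt// sqr_sqrtr.
Qed.

End Calculus.

(** * Scalar inequalities *)

Section Scalar.
Context {R : realType}.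
Implicit Types (a b c x y v w : R).

(** Every monomial of the binomial expansion is an exponential, to which
    1 + t <= exp t applies; the left-hand side sums these tangents with the
    binomial weights.  The shift [c] absorbs the exponents produced by the induction. *)
Lemma expR_combination_pow v w x y c k : 0 <= v -> 0 <= w -> v + w = 1 ->
  1 + c + k%:R * (v * x + w * y) <= expR c * (v * expR x + w * expR y) ^+ k.
Proof.
move=> v0 w0 vw; elim: k c => [|k IH] c.
  by rewrite mul0r addr0 expr0 mulr1 expR_ge1Dx.
have -> : expR c * (v * expR x + w * expR y) ^+ k.+1 =
   v * (expR (c + x) * (v * expR x + w * expR y) ^+ k) +
   w * (expR (c + y) * (v * expR x + w * expR y) ^+ k).
  by rewrite !expRD exprS; ring.
apply: le_trans (lerD (ler_wpM2l v0 (IH (c + x))) (ler_wpM2l w0 (IH (c + y)))).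
by rewrite -natr1 (_ : v = 1 - w); [lra | rewrite -vw addrK].
Qed.

(** The same with one extreme term of the binomial expansion removed in part:
    the remaining coefficients are still nonnegative as long as u <= v. *)
Lemma expR_combination_pow_sub u v w x y c k :
  0 <= u <= v -> 0 <= w -> v + w = 1 ->
  (1 - u ^+ k) * (1 + c) + k%:R * (v * x + w * y) - k%:R * u ^+ k * x <=
  expR c * ((v * expR x + w * expR y) ^+ k - u ^+ k * expR x ^+ k).
Proof.
move=> /andP[u0 uv] w0 vw; have v0 := le_trans u0 uv.
elim: k c => [|k IH] c.
  by rewrite !expr0 !mul0r mulr1 subrr !mul0r mulr0 addr0 subr0.
have -> : expR c * ((v * expR x + w * expR y) ^+ k.+1 - u ^+ k.+1 * expR x ^+ k.+1) =
   (v - u) * (expR (c + x) * (v * expR x + w * expR y) ^+ k) +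
   u * (expR (c + x) * ((v * expR x + w * expR y) ^+ k - u ^+ k * expR x ^+ k)) +
   w * (expR (c + y) * (v * expR x + w * expR y) ^+ k).
  by rewrite !expRD !exprS; ring.
have vu : 0 <= v - u by rewrite subr_ge0.
have B c' := @expR_combination_pow v w x y c' k v0 w0 vw.
apply: le_trans (lerD (lerD (ler_wpM2l vu (B (c + x))) (ler_wpM2l u0 (IH (c + x))))
  (ler_wpM2l w0 (B (c + y)))).
rewrite le_eqVlt; apply/orP; left; apply/eqP.
rewrite -natr1 exprS (_ : v = 1 - w); last by rewrite -vw addrK.
by ring.
Qed.

(** After moving the remainder to the right, (v a + w b)^k - w^k (a^k + b^k)
    + 2 w^k (ab)^(k/2) is a combination of monomials with nonnegative
    coefficients of sum 1 (as w <= v), whose weighted geometric mean is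
    (a^v b^w)^k. *)
Lemma refined_young_expR v w x y k : 0 <= w <= v -> v + w = 1 -> (0 < k)%N ->
  expR (v * x + w * y) ^+ k + w ^+ k * (expR (k%:R / 2 * x) - expR (k%:R / 2 * y)) ^+ 2
  <= (v * expR x + w * expR y) ^+ k.
Proof.
case: k => // k /andP[w0 wv] vw _.
have v0 := le_trans w0 wv.
(* Multiplying by exp c normalizes the geometric mean to 1. *)
pose c : R := - (k.+1%:R * (v * x + w * y)).
pose A := v * expR x + w * expR y.
have hx c' := @expR_combination_pow_sub w v w x y c' k (introT andP (conj w0 wv)) w0 vw.
have wv' : w + v = 1 by rewrite addrC.
have hy c' := @expR_combination_pow_sub w w v y x c' k (introT andP (conj w0 (lexx w))) v0 wv'.
have h0 c' := @expR_combination_pow v w x y c' k v0 w0 vw.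
have vw0 : 0 <= v - w by rewrite subr_ge0.
have hm := expR_ge1Dx (c + k.+1%:R / 2 * (x + y)).
have wk0 : 0 <= 2 * w ^+ k.+1 by rewrite mulr_ge0// exprn_ge0.
have sq : (expR (k.+1%:R / 2 * x) - expR (k.+1%:R / 2 * y)) ^+ 2 =
    expR x ^+ k.+1 + expR y ^+ k.+1 - 2 * expR (k.+1%:R / 2 * (x + y)).
  have half z : expR (k.+1%:R / 2 * z) ^+ 2 = expR z ^+ k.+1.
    by rewrite -!expRM_natl; congr expR; field.
  have -> : expR (k.+1%:R / 2 * (x + y)) = expR (k.+1%:R / 2 * x) * expR (k.+1%:R / 2 * y).
    by rewrite -expRD -mulrDr.
  by rewrite -!half; move: (expR _) (expR _) => s t; ring.
(* One factor v a + w b is expanded, as (v - w) a + w a + w b, so that the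
   subtracted monomials are taken from the last two products only. *)
have key : 1 <= expR c * (A ^+ k.+1 - w ^+ k.+1 * (expR x ^+ k.+1 + expR y ^+ k.+1
    - 2 * expR (k.+1%:R / 2 * (x + y)))).
  have -> : expR c * (A ^+ k.+1 - w ^+ k.+1 * (expR x ^+ k.+1 + expR y ^+ k.+1
    - 2 * expR (k.+1%:R / 2 * (x + y)))) =
    (v - w) * (expR (c + x) * A ^+ k) +
    w * (expR (c + x) * (A ^+ k - w ^+ k * expR x ^+ k)) +
    w * (expR (c + y) * ((w * expR y + v * expR x) ^+ k - w ^+ k * expR y ^+ k)) +
    2 * w ^+ k.+1 * expR (c + k.+1%:R / 2 * (x + y)).
    by rewrite !(expRD c) [w * expR y + _]addrC -/A !exprS /A; ring.
  apply: le_trans (lerD (lerD (lerD (ler_wpM2l vw0 (h0 (c + x))) (ler_wpM2l w0 (hx (c + x))))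
    (ler_wpM2l w0 (hy (c + y)))) (ler_wpM2l wk0 hm)).
  rewrite le_eqVlt; apply/orP; left; apply/eqP.
  rewrite /c -natr1 exprS (_ : v = 1 - w); last by rewrite -vw addrK.
  by field.
have inv : expR (v * x + w * y) ^+ k.+1 * expR c = 1.
  by rewrite -expRM_natl -expRD /c subrr expR0.
rewrite sq -lerBrDr -[leLHS]mulr1; apply: le_trans (ler_wpM2l (exprn_ge0 _ (expR_ge0 _)) key) _.
by rewrite [leLHS]mulrA inv mul1r.
Qed.

Lemma refined_young_pow v w a b k : 0 < v -> 0 < w -> v + w = 1 -> (0 < k)%N ->
  0 <= a -> 0 <= b ->
  (a `^ v * b `^ w) ^+ k
    + Num.min v w ^+ k * (a `^ (k%:R / 2) - b `^ (k%:R / 2)) ^+ 2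
  <= (v * a + w * b) ^+ k.
Proof.
move=> v0 w0 vw k0; wlog wv : v w a b v0 w0 vw / w <= v => [wl a0 b0|a0 b0].
  have /orP[wv|wv] := le_total w v; first exact: wl.
  rewrite minC [leRHS](congr1 (fun z => z ^+ k) (addrC _ _)) (mulrC (a `^ v)).
  have -> : (a `^ (k%:R / 2) - b `^ (k%:R / 2)) ^+ 2 =
            (b `^ (k%:R / 2) - a `^ (k%:R / 2)) ^+ 2 by ring.
  by apply: wl => //; rewrite addrC.
rewrite (min_idPr wv).
have k20 : (0 : R) < k%:R / 2 by rewrite divr_gt0// ltr0n.
have pk c : 0 <= c -> (c `^ (k%:R / 2)) ^+ 2 = c ^+ k.
  by move=> c0; rewrite -powR_mulrn ?powR_ge0// -powRrM divfK// powR_mulrn.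
have wv0 : 0 <= w <= v by rewrite wv (ltW w0).
move: a0; rewrite le_eqVlt => /orP[/eqP<-|a0].
  rewrite !powR0 ?gt_eqF//  mul0r expr0n gtn_eqF// add0r sub0r sqrrN pk//.
  by rewrite mulr0 add0r exprMn.
move: b0; rewrite le_eqVlt => /orP[/eqP<-|b0].
  rewrite !powR0 ?gt_eqF// mulr0 expr0n gtn_eqF// add0r subr0 pk ?(ltW a0)//.
  rewrite mulr0 addr0 exprMn ler_wpM2r ?exprn_ge0 ?(ltW a0)//.
  by rewrite ler_pXn2r ?nnegrE ?(ltW v0) ?(ltW w0).
have := @refined_young_expR v w (ln a) (ln b) k wv0 vw k0.
by rewrite !lnK ?posrE// /powR !gt_eqF// -expRD.
Qed.

Lemma powR_convex2 v w a b (r : R) : 0 <= v -> 0 <= w -> v + w = 1 -> 1 <= r ->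
  0 <= a -> 0 <= b ->
  (v * a + w * b) `^ r <= v * a `^ r + w * b `^ r.
Proof.
move=> v0 w0 vw r1 a0 b0.
have : 0 <= v * a + w * b by rewrite addr_ge0// mulr_ge0.
rewrite le_eqVlt => /orP[/eqP<-|m0].
  by rewrite powR0 ?gt_eqF ?(lt_le_trans ltr01)// addr_ge0// mulr_ge0 ?powR_ge0.
apply: le_trans (lerD (ler_wpM2l v0 (powR_tangent r1 m0 a0))
  (ler_wpM2l w0 (powR_tangent r1 m0 b0))).
set m := v * a + w * b; rewrite le_eqVlt; apply/orP; left; apply/eqP.
have -> : v * (m `^ r + r * m `^ (r - 1) * (a - m)) +
          w * (m `^ r + r * m `^ (r - 1) * (b - m)) =
   (v + w) * m `^ r + r * m `^ (r - 1) * (m - (v + w) * m) by rewrite /m; ring.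
by rewrite vw !mul1r subrr mulr0 addr0.
Qed.

(** The tangent lines of t^(K+1) at the mean of the [u i], summed over i. *)
Lemma power_mean n K (u : 'I_n -> R) : (forall i, 0 <= u i) ->
  (\sum_(i < n) u i) ^+ K.+1 <= n%:R ^+ K * \sum_(i < n) u i ^+ K.+1.
Proof.
move=> u0; have S0 : 0 <= \sum_(i < n) u i by apply: sumr_ge0.
case: n u u0 S0 => [|n] u u0 S0.
  by rewrite !big_ord0 expr0n mulr0.
move: S0; rewrite le_eqVlt => /orP[/eqP<-|S0].
  by rewrite expr0n mulr_ge0 ?exprn_ge0// sumr_ge0// => i _; rewrite exprn_ge0.
set S := \sum_(i < n.+1) u i in S0 *.
have n0 : (n.+1%:R : R) != 0 by rewrite pnatr_eq0.
pose mu := S / n.+1%:R; have mu0 : 0 < mu by rewrite divr_gt0// ltr0n.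
have K1 : (1 : R) <= K.+1%:R by rewrite ler1n.
have t i : mu ^+ K.+1 + K.+1%:R * mu `^ (K.+1%:R - 1) * (u i - mu) <= u i ^+ K.+1.
  by have := powR_tangent K1 mu0 (u0 i); rewrite !powR_mulrn// ltW.
have : n.+1%:R * mu ^+ K.+1 <= \sum_(i < n.+1) u i ^+ K.+1.
  apply: le_trans (ler_sum _ (fun i _ => t i)).
  rewrite big_split/= sumr_const card_ord -mulr_sumr big_split/= sumr_const card_ord.
  have -> : \sum_(i < n.+1) u i + (- mu) *+ n.+1 = 0.
    by rewrite -mulr_natr mulNr /mu divfK// subrr.
  by rewrite mulr0 addr0 mulr_natl.
move=> h; apply: le_trans (ler_wpM2l (exprn_ge0 K (ler0n _ n.+1)) h).
by rewrite mulrA -exprSr -exprMn /mu mulrC divfK.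
Qed.

(** All scalar steps between Cauchy-Schwarz and the operator norm: [al] and [be]
    stand for |S xi|^2 and |T^* xi|^2, [a], [b], [a'] and [b'] for the quadratic
    forms of powers of |S| and |T^*|, and [N] for the norm. *)
Lemma young_chain (p q r al be a b a' b' N u : R) k :
  1 < p -> 1 < q -> p^-1 + q^-1 = 1 -> 1 <= r -> (0 < k)%N ->
  0 <= al -> 0 <= be -> 0 <= u -> u ^+ 2 <= al * be ->
  al `^ p <= a -> be `^ q <= b -> a `^ r <= a' -> b `^ r <= b' ->
  p^-1 * a' + q^-1 * b' <= N ->
  u ^+ (2 * k) <= N `^ (k%:R / r) - Num.min p^-1 q^-1 ^+ k *
    (a `^ (k%:R / 2) - b `^ (k%:R / 2)) ^+ 2.
Proof.
move=> p1 q1 pq r1 k0 al0 be0 u0 uab ala beb aa bb N1.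
have p0 : 0 < p^-1 by rewrite invr_gt0 (lt_trans ltr01).
have q0 : 0 < q^-1 by rewrite invr_gt0 (lt_trans ltr01).
have a0 : 0 <= a by apply: le_trans ala; apply: powR_ge0.
have b0 : 0 <= b by apply: le_trans beb; apply: powR_ge0.
have r0 : 0 < r by rewrite (lt_le_trans ltr01).
rewrite lerBrDr; apply: (@le_trans _ _ ((p^-1 * a + q^-1 * b) ^+ k)).
  apply: le_trans (refined_young_pow p0 q0 pq k0 a0 b0); rewrite lerD2r.
  rewrite exprM ler_pXn2r ?nnegrE ?sqr_ge0 ?mulr_ge0 ?powR_ge0//.
  apply: (le_trans uab); apply: ler_pM => //.
    have -> : al = (al `^ p) `^ p^-1.
      by rewrite -powRrM divff ?powRr1// gt_eqF// (lt_trans ltr01).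
    by rewrite ge0_ler_powR ?nnegrE ?powR_ge0 ?(ltW p0).
  have -> : be = (be `^ q) `^ q^-1.
    by rewrite -powRrM divff ?powRr1// gt_eqF// (lt_trans ltr01).
  by rewrite ge0_ler_powR ?nnegrE ?powR_ge0 ?(ltW q0).
set m := _ + _.
have m0 : 0 <= m by rewrite addr_ge0// mulr_ge0 ?(ltW p0) ?(ltW q0).
have -> : m ^+ k = (m `^ r) `^ (k%:R / r).
  by rewrite -powRrM mulrC divfK ?powR_mulrn// gt_eqF.
have mN : m `^ r <= N.
  apply: (le_trans (powR_convex2 (ltW p0) (ltW q0) pq r1 a0 b0)).
  by apply: le_trans N1; apply: lerD; rewrite ler_pM2l.
rewrite ge0_ler_powR ?nnegrE ?powR_ge0 ?divr_ge0 ?(ltW r0)//.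
by apply: le_trans mN; apply: powR_ge0.
Qed.

End Scalar.

(** * Numerical radius of sums of products *)

Section ProductForm.
Context {R : realType} {H : completeNormedModType R[i]}.
Context (dot : {dot H for Num.conj}).
Context (dot_norm : forall x : H, dot x x = `|x| ^+ 2).
Local Notation ip := (rdot dot).

(** McCarthy's inequality for the pairs (X^2, X^2s) and (X^2s, X^2rs), where
    X = |T|; for the first pair, <X^2 xi, xi> is |T xi|^2. *)
Lemma op_abs_power_jensen (T : H -> H) (r s : R) (xi : H) :
  bounded_op T -> 1 <= r -> 1 <= s -> rnorm xi = 1 ->
  [/\ bounded_op (op_power (op_abs dot T) (2 * r * s)),
      (rnorm (T xi) ^+ 2) `^ s <= ip (op_power (op_abs dot T) (2 * s) xi) xi &
      ip (op_power (op_abs dot T) (2 * s) xi) xi `^ r <=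
      ip (op_power (op_abs dot T) (2 * r * s) xi) xi].
Proof.
move=> bT r1 s1 xi1; have [saX posX rnormX] := op_abs_spec dot_norm bT.
have s2 : 1 <= 2 * s by lra.
have rs2 : 1 <= 2 * r * s by nra.
have [c1 [M hM]] := op_power_calculus dot_norm saX posX (or_intror s2).
have [c2 _] := op_power_calculus dot_norm saX posX (or_intror rs2).
split; first by case: c2.
  have -> : rnorm (T xi) ^+ 2 = ip (rpoly_op ('X * 'X) (op_abs dot T) xi) xi.
    by rewrite -rnormX -(rdotxx dot_norm) rpoly_opM ?rpoly_opX ?saX.2//; case: saX => -[].
  apply: (real_calculus_jensen dot_norm saX s1
    (real_calculus_poly ('X * 'X) saX.1) c1 _ _ xi1).
    by move=> t /hM/andP[t0 _]; rewrite hornerM hornerX mulr_ge0.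
  move=> t /hM/andP[t0 _]; rewrite hornerM hornerX -expr2.
  by rewrite powRrM powR_mulrn.
apply: (real_calculus_jensen dot_norm saX r1 c1 c2 _ _ xi1).
  by move=> t _; apply: powR_ge0.
by move=> t _; rewrite -powRrM; congr (_ `^ _); ring.
Qed.

(** The inequality for a single product TS: the adjoint moves T to the other
    side of the form, so that Cauchy-Schwarz applies to S xi and T^* xi. *)
Lemma refined_young_form (S T : H -> H) (p q r : R) k (xi : H) :
  bounded_op S -> bounded_op T -> 1 < p -> 1 < q -> p^-1 + q^-1 = 1 ->
  1 <= r -> (0 < k)%N -> rnorm xi = 1 ->
  complex.Re `|dot (T (S xi)) xi| ^+ (2 * k) <=
  opnorm ((p^-1)%:C *: op_power (op_abs dot S) (2 * r * p)
          + (q^-1)%:C *: op_power (op_abs dot (adjoint dot T)) (2 * q * r))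
    `^ (k%:R / r)
  - Num.min p^-1 q^-1 ^+ k *
    (ip (op_power (op_abs dot S) (2 * p) xi) xi `^ (k%:R / 2)
     - ip (op_power (op_abs dot (adjoint dot T)) (2 * q) xi) xi `^ (k%:R / 2)) ^+ 2.
Proof.
move=> bS bT p1 q1 pq r1 k0 xi1.
have [bT' aT] := adjoint_spec dot_norm bT.
have [bX X1 X2] := op_abs_power_jensen bS r1 (ltW p1) xi1.
have [bY Y1 Y2] := op_abs_power_jensen bT' r1 (ltW q1) xi1.
have -> : 2 * q * r = 2 * r * q by ring.
apply: (young_chain p1 q1 pq r1 k0 (sqr_ge0 _) (sqr_ge0 _) _ _ X1 Y1 X2 Y2).
- exact: Re_norm_ge0.
- rewrite aT -exprMn ler_pXn2r ?nnegrE ?Re_norm_ge0 ?mulr_ge0 ?rnorm_ge0//.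
  exact: dot_le.
rewrite -!rdotZl -rdotDl.
set Z := (Z in opnorm Z); change (ip (Z xi) xi <= opnorm Z).
have bZ : bounded_op Z := bounded_opD (bounded_opZ _ bX) (bounded_opZ _ bY).
apply: (@le_trans _ _ (rnorm (Z xi) * rnorm xi)); first exact: rdot_le.
by rewrite xi1 mulr1; have := opnorm_ge xi bZ; rewrite xi1 mulr1.
Qed.

End ProductForm.

Theorem theorem3p10 (R : realType) (H : completeNormedModType R[i])
    (dot : {dot H for Num.conj})
    (dot_norm : forall x : H, dot x x = `|x| ^+ 2)
    (n m k : nat) (n_ge1 : (1 <= n)%N) (m_ge1 : (1 <= m)%N) (k_ge1 : (1 <= k)%N)
    (A C D : 'I_n -> H -> H)
    (bA : forall i, bounded_op (A i))
    (bC : forall i, bounded_op (C i))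
    (bD : forall i, bounded_op (D i))
    (p q : R) (p_gt1 : 1 < p) (q_gt1 : 1 < q) (pq : p^-1 + q^-1 = 1)
    (r : R) (r_ge1 : 1 <= r) :
  let X (j : nat) (i : 'I_n) := op_abs dot (iter j (C i) \o A i) in
  let Y (j : nat) (i : 'I_n) :=
    op_abs dot (adjoint dot (D i \o iter (m - j) (C i))) in
  let r0 := Num.min p^-1 q^-1 in
  let eta (xi : H) : R :=
    n%:R ^+ (2 * k - 1) / m%:R *
    \sum_(1 <= j < m.+1) \sum_(i < n)
      (complex.Re (dot (op_power (X j i) (2 * p) xi) xi) `^ (k%:R / 2)
       - complex.Re (dot (op_power (Y j i) (2 * q) xi) xi) `^ (k%:R / 2)) ^+ 2 in
  numradius dot (\sum_(i < n) (D i \o iter m (C i) \o A i)) ^+ (2 * k)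
  <= n%:R ^+ (2 * k - 1) / m%:R *
     (\sum_(1 <= j < m.+1) \sum_(i < n)
        opnorm ((p^-1)%:C *: op_power (X j i) (2 * r * p)
                + (q^-1)%:C *: op_power (Y j i) (2 * q * r)) `^ (k%:R / r))
     - r0 ^+ k * inf [set eta xi | xi in [set xi : H | `|xi| = 1]].
Proof.
pose X (j : nat) (i : 'I_n) := op_abs dot (iter j (C i) \o A i).
pose Y (j : nat) (i : 'I_n) :=
  op_abs dot (adjoint dot (D i \o iter (m - j) (C i))).
pose r0 := Num.min p^-1 q^-1.
have bCA i j : bounded_op (iter j (C i) \o A i).
  by apply: bounded_op_comp => //; apply: bounded_op_iter.
have bDC i j : bounded_op (D i \o iter (m - j) (C i)).
  by apply: bounded_op_comp => //; apply: bounded_op_iter.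
pose N j i := opnorm ((p^-1)%:C *: op_power (X j i) (2 * r * p)
                + (q^-1)%:C *: op_power (Y j i) (2 * q * r)).
pose a j i xi := rdot dot (op_power (X j i) (2 * p) xi) xi.
pose b j i xi := rdot dot (op_power (Y j i) (2 * q) xi) xi.
pose eta (xi : H) : R := n%:R ^+ (2 * k - 1) / m%:R *
  \sum_(1 <= j < m.+1) \sum_(i < n)
    (a j i xi `^ (k%:R / 2) - b j i xi `^ (k%:R / 2)) ^+ 2.
pose W : H -> H := \sum_(i < n) (D i \o iter m (C i) \o A i).
(* The coercion from bool stands outside the local definitions of the statement,
   so they cannot be introduced; they are restated instead. *)
change (numradius dot W ^+ (2 * k) <= n%:R ^+ (2 * k - 1) / m%:R *
     (\sum_(1 <= j < m.+1) \sum_(i < n) N j i `^ (k%:R / r))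
     - r0 ^+ k * inf [set eta xi | xi in [set xi : H | `|xi| = 1]]).
have p0 : 0 < p by apply: lt_trans p_gt1.
have q0 : 0 < q by apply: lt_trans q_gt1.
have term j i xi : (1 <= j <= m)%N -> rnorm xi = 1 ->
   complex.Re `|dot (D i (iter m (C i) (A i xi))) xi| ^+ (2 * k) <=
   N j i `^ (k%:R / r) - r0 ^+ k * (a j i xi `^ (k%:R / 2) - b j i xi `^ (k%:R / 2)) ^+ 2.
  move=> /andP[j1 jm] xi1.
  have -> : D i (iter m (C i) (A i xi)) =
      (D i \o iter (m - j) (C i)) ((iter j (C i) \o A i) xi).
    by rewrite /= -iterD subnK.
  exact: refined_young_form.
have coef0 : 0 <= n%:R ^+ (2 * k - 1) / m%:R :> R by rewrite divr_ge0 ?exprn_ge0.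
pose RHS xi := n%:R ^+ (2 * k - 1) / m%:R *
     (\sum_(1 <= j < m.+1) \sum_(i < n) N j i `^ (k%:R / r)) - r0 ^+ k * eta xi.
have bound xi : rnorm xi = 1 ->
  complex.Re `|dot (W xi) xi| ^+ (2 * k)
  <= RHS xi.
  move=> xi1; pose u (i : 'I_n) := complex.Re `|dot (D i (iter m (C i) (A i xi))) xi|.
  have k2 : (2 * k = (2 * k - 1).+1)%N by rewrite subn1 prednK// muln_gt0.
  apply: (@le_trans _ _ ((\sum_(i < n) u i) ^+ (2 * k))).
    apply: lerXn2r; rewrite ?nnegrE; first exact: Re_norm_ge0.
      by apply: sumr_ge0 => i _; exact: Re_norm_ge0.
    rewrite /W fct_sumE linear_sumlz /u.
    elim/big_rec2: _ => [|i y z _ IH]; first by rewrite normr0.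
    apply: le_trans (lerD (lexx _) IH).
    rewrite -lecR (rmorphD (@real_complex R)) !RRe_real ?normr_real//.
    exact: ler_normD.
  rewrite [in leLHS]k2; apply: (le_trans (power_mean _ _)).
    by move=> i; apply: Re_norm_ge0.
  rewrite -k2.
  have -> : RHS xi = n%:R ^+ (2 * k - 1) * (m%:R^-1 * \sum_(1 <= j < m.+1) \sum_(i < n)
     (N j i `^ (k%:R / r) - r0 ^+ k * (a j i xi `^ (k%:R / 2) - b j i xi `^ (k%:R / 2)) ^+ 2)).
    rewrite /RHS /eta mulrCA -mulrBr -mulrA; congr (_ * (_ * _)).
    rewrite mulr_sumr -sumrB; apply: eq_bigr => j _.
    by rewrite mulr_sumr -sumrB.
  rewrite ler_wpM2l ?exprn_ge0// ler_pdivlMl ?ltr0n//.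
  have -> (S : R) : m%:R * S = \sum_(1 <= j < m.+1) S.
    by rewrite sumr_const_nat subn1 mulr_natl.
  apply: ler_sum_nat => j /andP[j1 jm]; apply: ler_sum => i _.
  by apply: term; rewrite ?j1.
have r00 : 0 <= r0 ^+ k by rewrite exprn_ge0// le_min !invr_ge0 (ltW p0) (ltW q0).
have eta0 xi : 0 <= eta xi.
  rewrite mulr_ge0//; apply: sumr_ge0 => j _; apply: sumr_ge0 => i _; exact: sqr_ge0.
have main0 : 0 <= n%:R ^+ (2 * k - 1) / m%:R *
     (\sum_(1 <= j < m.+1) \sum_(i < n) N j i `^ (k%:R / r)).
  by rewrite mulr_ge0//; apply: sumr_ge0 => j _; apply: sumr_ge0 => i _; exact: powR_ge0.
have rnorm1 (xi : H) : `|xi| = 1 -> rnorm xi = 1 by rewrite /rnorm => ->.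
(* In the zero space the supremum and the infimum are over empty sets. *)
have [[xi0 xi01]|none] := pselect (exists xi : H, `|xi| = 1); last first.
  have e0 : [set xi : H | `|xi| = 1] = set0.
    by apply/seteqP; split=> // xi xi1; apply: none; exists xi.
  rewrite /numradius e0 !image_set0 sup0 inf0 expr0n gtn_eqF ?muln_gt0//.
  by rewrite mulr0 subr0.
set B := leRHS.
have le_B xi : `|xi| = 1 -> 
  complex.Re `|dot (W xi) xi| ^+ (2 * k) <= B.
  move=> xi1; apply: (le_trans (bound _ (rnorm1 _ xi1))); rewrite lerD2l lerN2.
  rewrite ler_wpM2l//; apply: ge_inf; last by exists xi.
  by exists 0 => _ [y _ <-].
have k20 : (0 < 2 * k)%N by rewrite muln_gt0.
have B0 : 0 <= B by apply: le_trans (le_B _ xi01); rewrite exprn_ge0 ?Re_norm_ge0.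
have rootE : (B `^ (2 * k)%:R^-1) ^+ (2 * k) = B.
  by rewrite -powR_mulrn ?powR_ge0// -powRrM mulVf ?powRr1// pnatr_eq0 -lt0n.
have w0 : 0 <= numradius dot W.
  rewrite /numradius; set E := [set _ | _ in _].
  have [hE|/sup_out-> //] := pselect (has_sup E).
  apply: (@le_trans _ _ (complex.Re `|dot (W xi0) xi0|)); first exact: Re_norm_ge0.
  by apply: sup_upper_bound => //; exists xi0.
rewrite -rootE ler_pXn2r ?nnegrE ?powR_ge0//.
apply: ge_sup; first by eexists; exists xi0.
move=> _ [y /= y1 <-].
by rewrite -(@ler_pXn2r _ (2 * k)) ?nnegrE ?powR_ge0 ?Re_norm_ge0// rootE le_B.
Qed.
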